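(* Let $n,s,k\ge1$ be integers with $n/s$ an integer and $ks\le n$, let $m>0$, $\delta\in(0,1)$, let $\mathcal{C}$ be the class of unions of $k$ pairwise disjoint $s$-intervals in $\{1,\dots,n\}$, and suppose the signal magnitude $\mu>0$ satisfies $$\mu \geq \sqrt{\frac{2n}{sm} \log \frac{2k}{\delta} + \frac{2ks}{m} \log \frac{4n}{\delta}} .$$ Then the search/refinement procedure for unions of $s$-intervals described in the context, with sufficiently small measurement precision $\Gamma$, results in an estimator $\hat S$ satisfying $$\max_{S\in\mathcal{C}}\mathbb{P}_S(\hat S\ne S)\le\delta ,$$ and satisfies the precision budget $\mathbb{E}_S\big(\sum_j\Gamma_j\big)\le m$ for every $S\in\mathcal{C}$.
   Context: An $s$-interval is a set $\{i,i+1,\dots,i+s-1\}$ with $1\le i\le n-s+1$. Sensing model. For an unknown support set $S\in\mathcal{C}$ and $\mu>0$, the signal $\boldsymbol{x}\in\mathbb{R}^n$ has $x_i=\mu$ if $i\in S$ and $x_i=0$ otherwise. One collects measurements $Y_j=x_{A_j}+\Gamma_j^{-1/2}W_j$, $j=1,2,\dots$, where $A_j\in\{1,\dots,n\}$ is the measured coordinate, $\Gamma_j>0$ is its precision, and the $W_j$ are i.i.d. $\mathcal{N}(0,1)$ with $W_j$ independent of $\{A_i,\Gamma_i\}_{i\le j}$. In adaptive sensing $A_j,\Gamma_j$ may depend on $\{Y_i,A_i,\Gamma_i\}_{i<j}$. Sums over $j$ run over the measurements made. The values $n,m,\mu$ and the class $\mathcal{C}$ are known; only $S$ is unknown. $\mathbb{P}_S,\mathbb{E}_S$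 are probability and expectation when the support is $S$. Procedure. All measurements have the same precision $\Gamma_j=\Gamma$, taken sufficiently small. At step $t=1,2,\dots$ the procedure queries a coordinate $Q_t$ (no coordinate is queried twice) and computes a binary answer $\Psi_t$ (a surrogate for $\mathbf{1}\{Q_t\in S\}$) by a sequential likelihood ratio test with target type I and type II error probabilities $\alpha_t,\beta_t$: coordinate $Q_t$ is measured repeatedly, giving $y_1,y_2,\dots$, until the first $r$ at which $\bar z_r=\sum_{i=1}^r\log\frac{f_1(y_i)}{f_0(y_i)}$ leaves the interval $(l_t,u_t)$, where $f_0,f_1$ are the densities of $\mathcal{N}(0,\Gamma^{-1})$ and $\mathcal{N}(\mu,\Gamma^{-1})$, $l_t=\log\frac{\beta_t}{1-\alpha_t}$ and $u_t=\log\frac{1-\beta_t}{\alpha_t}$; then $\Psi_t=1$ if $\bar z_r\ge u_t$ and $\Psi_t=0$ if $\bar z_r\le l_t$. A coordinate is treated as non-zero when its answer is $1$. Queries: in the search phase coordinates $1,s+1,2s+1,\dots$ are queried until $k$ non-zero coordinates are found; in the refinement phase coordinates to the left of the non-zero coordinates found in the search phase are queried to find the left endpoints of all $k$ intervals. Error probabilities: $\alpha_t=\delta/(4n)$ for all $t$, $\beta_t=\delta/(2k)$ in the search phase, $\beta_t=\delta/(4ks)$ in the refinement phase. The procedure stops at the first step $T$ at which there is at most one $S'\in\mathcal{C}$ with $\Psi_i=\mathbf{1}\{Q_i\in S'\}$ for all $i\le T$. The estimator $\hat S$ is this unique $S'$ if it exists, and $\hat S=\emptyset$ otherwise. *)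

(* Defs.v *)
(* MathComp-Analysis *)
From mathcomp Require Import all_boot all_order all_algebra.
From mathcomp Require Import all_classical all_reals all_analysis.

Set Implicit Arguments.
Unset Strict Implicit.
Unset Printing Implicit Defensive.

Import Order.TTheory GRing.Theory Num.Theory.

Local Open Scope ring_scope.

(** Coordinates are numbered from 0: the coordinate i in {1, ..., n} is the
    ordinal i - 1 of 'I_n. *)

Section SupportClass.
Local Open Scope nat_scope.
Variables (n s k : nat).

Definition s_interval (A : {set 'I_n}) : bool :=
  [exists i : 'I_n, (i + s <= n) && (A == [set c : 'I_n | i <= c < i + s])].

(** Finite unions of k pairwise disjoint s-intervals; adjacent intervals are
    allowed.  For 0 < s intervals are nonempty, so that a family of k pairwise
    disjoint intervals is the same thing as a set of k of them. *)
Definition interval_unions : {set {set 'I_n}} :=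
  [set S | [exists I : {set {set 'I_n}},
    [&& #|I| == k, [forall A in I, s_interval A], finset.trivIset I & finset.cover I == S]]].

End SupportClass.

(** The pairs (Q_1, Psi_1), ..., (Q_t, Psi_t), in this order. *)
Definition history (n : nat) : Type := seq ('I_n * bool).

Section Queries.
Local Open Scope nat_scope.
Variables (n s k : nat).
Implicit Types (h : history n) (S : {set 'I_n}).

Definition consistent h S : bool := all (fun qa => qa.2 == (qa.1 \in S)) h.

Definition candidates h : {set {set 'I_n}} :=
  [set S in interval_unions n s k | consistent h S].

(** Steps are numbered from 1, so the procedure never stops before its first
    answer. *)
Definition stopped h : bool := (0 < size h) && (#|candidates h| <= 1).

(** Meant for stopped histories, which have at most one candidate. *)
Definition estimate h : {set 'I_n} :=
  if [pick A in candidates h] is Some A then A else finset.set0.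

(** The search phase ends at the k-th answer 1, hence the non-zero coordinates
    it finds are those of the first k answers equal to 1. *)
Definition search_hits h : seq 'I_n := take k [seq qa.1 | qa <- h & qa.2].

Definition search_phase h : bool := size (search_hits h) < k.

(** The left endpoint of an s-interval containing p lies in {p-s+1, ..., p}. *)
Definition refinement_query h (c : 'I_n) : Prop :=
  c \notin [seq qa.1 | qa <- h] /\
  exists2 p : 'I_n, p \in search_hits h & c < p < c + s.

(** [q h] is the coordinate queried after the history [h].  The order in which
    the refinement phase visits the coordinates is left free.  The premises only
    exclude histories after which there is nothing left to query. *)
Definition search_refinement_rule (q : history n -> 'I_n) : Prop :=
  forall h, ~~ stopped h ->
    if search_phase h then size h * s < n -> q h = size h * s :> nat
    else (exists c, refinement_query h c) -> refinement_query h (q h).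

End Queries.

Section Procedure.
Variables (R : realType) (n s k : nat) (delta mu Gamma : R).
Variable q : history n -> 'I_n.

Definition type1_error : R := delta / (4 * n%:R).

Definition type2_error (h : history n) : R :=
  if search_phase k h then delta / (2 * k%:R) else delta / (4 * k%:R * s%:R).

Definition lower_threshold (h : history n) : R := ln (type2_error h / (1 - type1_error)).
Definition upper_threshold (h : history n) : R := ln ((1 - type2_error h) / type1_error).

(** [normal_pdf] takes the standard deviation as its second argument. *)
Definition log_likelihood_ratio (y : R) : R :=
  ln (normal_pdf mu (Num.sqrt Gamma^-1) y / normal_pdf 0 (Num.sqrt Gamma^-1) y).

Definition signal (S : {set 'I_n}) (i : 'I_n) : R := if i \in S then mu else 0.

(** Answers given so far, and cumulative log-likelihood ratio of the test of
    the current coordinate [q h]. *)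
Definition state : Type := (history n * R)%type.

Definition update (st : state) (y : R) : state :=
  let h := st.1 in
  let z := st.2 + log_likelihood_ratio y in
  if upper_threshold h <= z then (rcons h (q h, true), 0)
  else if z <= lower_threshold h then (rcons h (q h, false), 0)
  else (h, z).

Section Trajectory.
Variables (S : {set 'I_n}) (w : nat -> R).

(** State after the first j measurements, the measurement number j + 1 being
    [signal S A + Gamma ^ (-1/2) * w j] with A the current coordinate; the state
    no longer changes once the procedure has stopped. *)
Fixpoint state_after (j : nat) : state :=
  if j is i.+1 then
    let st := state_after i in
    if stopped s k st.1 then st
    else update st (signal S (q st.1) + (Num.sqrt Gamma)^-1 * w i)
  else ([::], 0).

Definition halted (j : nat) : bool := stopped s k (state_after j).1.

(** The value is the empty set if the procedure never stops. *)
Definition estimator : {set 'I_n} :=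
  match pselect (exists j, halted j) with
  | left stops => estimate s k (state_after (ex_minn stops)).1
  | right _ => finset.set0
  end.

(** Sum of the precisions of the measurements made: measurement j + 1 is made
    when the procedure has not stopped after j measurements. *)
Definition total_precision : \bar R :=
  (\sum_(0 <= j <oo | ~~ halted j) Gamma%:E)%E.

End Trajectory.
End Procedure.

Section Noise.
Local Open Scope ereal_scope.
Local Open Scope classical_set_scope.
Variables (d : measure_display) (T : measurableType d) (R : realType).
Variables (P : probability T R) (W : nat -> {RV P >-> R}).

Definition mutually_independent : Prop :=
  forall (J : seq nat) (B : nat -> set R),
    uniq J -> (forall j, measurable (B j)) ->
    P (\big[setI/setT]_(j <- J) (W j @^-1` B j))
    = \prod_(j <- J) P (W j @^-1` B j).

Definition iid_standard_normal : Prop :=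
  mutually_independent /\
  forall (j : nat) (B : set R), measurable B ->
    distribution P (W j) B = normal_prob 0%R 1%R B.

End Noise.

(* Main.v *)
(** The pair (answers given so far, log-likelihood ratio of the current test) is
    a Markov chain, and both claims follow from potentials that decrease in
    conditional mean along it, whose value at a fresh state is at most the total
    cost of the queries that are still possible.  This total is bounded pathwise:
    each s-interval contains exactly one grid coordinate, so there are at most
    n/s search queries, exactly k of them at non-zero coordinates, and at most
    k(s-1) refinement queries.

    Precision: inside a test the potential is 2/mu^2 times the distance to the
    threshold favoured by the truth, plus a term K sigma (sigma = mu sqrt Gamma)
    that pays for the Gaussian overshoot.  Since ln(1-beta) <= -alpha and
    ln(1-alpha) <= -alpha, this term is absorbed once K sigma <= alpha.

    Errors: exp(z - u) and exp(l - z) are martingales under the two hypotheses,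
    so that, whatever the overshoot, a test errs with probability at most
    alpha/(1-beta) or beta/(1-alpha).  As the queries after correct answers are
    deterministic, these bounds add up to at most delta. *)

Require Import Defs.
From mathcomp Require Import all_boot all_order all_algebra.
From mathcomp Require Import all_classical all_reals all_analysis.
From mathcomp Require Import measurable_realfun ring lra zify.

Set Implicit Arguments.
Unset Strict Implicit.
Unset Printing Implicit Defensive.

Import Order.TTheory GRing.Theory Num.Theory.
Local Open Scope ring_scope.

(** * Gaussian integrals *)

Section Gaussian.
Import numFieldNormedType.Exports HBNNSimple.
Local Open Scope classical_set_scope.
Context {R : realType}.
Notation leb := (@lebesgue_measure R).
Notation gauss := (@normal_prob R 0 1).

(** Lebesgue measure is determined by its values on half-open intervals, and a translation preserves
    their lengths. *)
Lemma lebesgue_measure_shift (h : R) (A : set R) : measurable A ->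
  pushforward leb ((fun x => x + h) : _ -> measurableTypeR R) A = leb A.
Proof.
move=> mA.
have mh : measurable_fun setT ((fun x => x + h) : measurableTypeR R -> measurableTypeR R).
  exact: measurable_funD.
apply/esym/lebesgue_measure_unique => //= _ [[a b]] _ <-.
rewrite /pushforward /=.
have -> : (fun x : R => x + h) @^-1` `]a, b] = `]a - h, b - h]%classic.
  by apply/seteqP; split => x /=; rewrite !in_itv /=; lra.
rewrite !lebesgue_measure_itv/= !lte_fin ltrD2r.
by case: ifP => // _; congr (_%:E); lra.
Qed.

Local Open Scope ereal_scope.

Lemma ge0_integral_lebesgue_shift (h : R) (f : R -> \bar R) :
  measurable_fun setT f -> (forall x, 0 <= f x) ->
  \int[leb]_x f (x + h)%R = \int[leb]_x f x.
Proof.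
move=> mf f0.
have mh : measurable_fun setT ((fun x => x + h)%R : measurableTypeR R -> measurableTypeR R).
  exact: measurable_funD.
rewrite -(preimage_setT ((fun x => x + h)%R : measurableTypeR R -> measurableTypeR R)).
rewrite -(ge0_integral_pushforward mh) //=.
apply: eq_measure_integral => A mA _.
exact: (lebesgue_measure_shift h).
Qed.

(** On sets [normal_prob] is by definition an integral of the density; monotone convergence along
    simple functions carries this over to integrands. *)
Lemma ge0_integral_normal (m s : R) (f : R -> \bar R) :
  measurable_fun setT f -> (forall x, 0 <= f x) ->
  \int[normal_prob m s]_x f x = \int[leb]_x (f x * (normal_pdf m s x)%:E).
Proof.
move=> mf f0.
have mpdf := measurable_normal_pdf m s.
have pdf0 x : (0 <= (normal_pdf m s x)%:E) by rewrite lee_fin normal_pdf_ge0.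
pose g := nnsfun_approx measurableT mf.
have gE x : f x = limn (fun n => (g n x)%:E).
  by apply/esym/cvg_lim => //; exact: cvg_nnsfun_approx.
have mg n : measurable_fun setT (fun x => (g n x)%:E) by exact/measurable_EFinP.
have ndg x a b : (a <= b)%N -> (g a x)%:E <= (g b x)%:E.
  move=> ab; rewrite lee_fin; exact: (lefP _ _ (nd_nnsfun_approx measurableT mf ab)).
have mpdfE : measurable_fun setT (fun x => (normal_pdf m s x)%:E).
  exact/measurable_EFinP.
have mgpdf n : measurable_fun setT (fun x => (g n x)%:E * (normal_pdf m s x)%:E).
  exact: emeasurable_funM.
transitivity (limn (fun n => \int[normal_prob m s]_x (g n x)%:E)).
  under eq_integral do rewrite gE.
  apply: monotone_convergence => //.
  - by move=> n x _; rewrite lee_fin.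
  - by move=> x _ a b; exact: ndg.
transitivity (limn (fun n => \int[leb]_x ((g n x)%:E * (normal_pdf m s x)%:E))); last first.
  rewrite -monotone_convergence //.
  - apply: eq_integral => x _; rewrite gE; apply/cvg_lim => //.
    apply: cvgeZr => //; apply/cvg_ex; exists (f x); exact: cvg_nnsfun_approx.
  - by move=> n x _; rewrite mule_ge0 // lee_fin.
  - move=> x _ a b ab; apply: lee_wpmul2r => //.
    exact: ndg.
congr (limn _); apply/funext => n.
have mI r : measurable_fun setT (fun x : R => (r * \1_(g n @^-1` [set r]) x)%:E).
  by apply/measurable_EFinP; exact: measurable_funM.
have mI1 r : measurable_fun setT (fun x : R => (\1_(g n @^-1` [set r]) x : R)%:E).
  exact/measurable_EFinP.
have gsum x : (g n x)%:E =
    \sum_(r \in range (g n)) (r * \1_(g n @^-1` [set r]) x)%:E.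
  by rewrite fsumEFin// -fimfunE.
under eq_integral do rewrite gsum.
under [RHS]eq_integral => x _.
  rewrite gsum ge0_mule_fsuml; last by move=> r; rewrite EFinM nnfun_muleindic_ge0.
  over.
rewrite ge0_integral_fsum //; last by move=> r x _; rewrite EFinM nnfun_muleindic_ge0.
rewrite ge0_integral_fsum //; last 2 first.
- move=> r; exact: (emeasurable_funM (mI r) mpdfE).
- by move=> r x _; rewrite mule_ge0 // EFinM nnfun_muleindic_ge0.
apply: eq_fsbigr => r _.
(* A negative level has an empty preimage; the factor [r] is pulled out of the integrals when it is
   nonnegative. *)
have [r0|r0] := ltP r 0%R.
  rewrite preimage_nnfun0//.
  rewrite !integral0_eq// => x _; by rewrite indic0 mulr0 ?mul0e.
under eq_integral do rewrite EFinM.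
under [RHS]eq_integral do rewrite EFinM -muleA.
rewrite !ge0_integralZl_EFin //.
- congr (_ * _).
  transitivity (normal_prob m s (g n @^-1` [set r])); last rewrite /normal_prob [LHS]integral_mkcond.
    rewrite integral_indic //; last exact: (measurable_funPTI (g n) (measurable_set1 r)).
    by apply: (congr1 (normal_prob m s)); exact: setIT.
  apply: eq_integral => x _.
  by rewrite patchE indicE; case: ifP => _; rewrite ?mul1e ?mul0e.
- by move=> x _; rewrite mule_ge0 // lee_fin.
- exact: (emeasurable_funM (mI1 r) mpdfE).
- exact: mI1.
Qed.
(** The one-dimensional Cameron-Martin formula: the exponential is the ratio of the densities of
    N(h, 1) and N(0, 1). *)
Lemma ge0_integral_gauss_shift (h : R) (f : R -> \bar R) :
  measurable_fun setT f -> (forall x, 0 <= f x) ->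
  \int[gauss]_w f (w + h)%R = \int[gauss]_w (f w * (expR (h * w - h ^+ 2 / 2))%:E).
Proof.
move=> mf f0.
have mD : measurable_fun setT (fun w : R => (w + h)%R) by exact: measurable_funD.
have mE : measurable_fun setT (fun w : R => (expR (h * w - h ^+ 2 / 2))%:E).
  apply/measurable_EFinP; apply: measurableT_comp => //.
  by apply: measurable_funB => //; exact: measurable_funM.
have mpdf m : measurable_fun setT (fun x : R => (normal_pdf m 1 x)%:E).
  by apply/measurable_EFinP; exact: measurable_normal_pdf.
rewrite ge0_integral_normal //; last exact: measurableT_comp.
rewrite ge0_integral_normal //; last 2 first.
- exact: emeasurable_funM.
- by move=> x; rewrite mule_ge0 // lee_fin expR_ge0.
transitivity (\int[leb]_x (f x * (normal_pdf h 1 x)%:E)).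
  rewrite -[RHS](@ge0_integral_lebesgue_shift h (fun x => f x * (normal_pdf h 1 x)%:E)); first last.
  - by move=> x; rewrite mule_ge0 // lee_fin normal_pdf_ge0.
  - exact: emeasurable_funM.
  - apply: eq_integral => x _; congr (_ * _%:E).
    rewrite !normal_pdfE ?oner_eq0//; congr (_ * _)%R.
    by rewrite /normal_fun; congr expR; field.
apply: eq_integral => x _; rewrite -muleA; congr (_ * _); rewrite -EFinM; congr (_%:E).
rewrite !normal_pdfE ?oner_eq0// mulrCA; congr (_ * _)%R.
by rewrite /normal_fun -expRD; congr expR; field.
Qed.

Lemma ge0_integral_lebesgueN (f : R -> \bar R) :
  measurable_fun setT f -> (forall x, 0 <= f x) ->
  \int[leb]_x f (- x)%R = \int[leb]_x f x.
Proof.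
move=> mf f0.
have mN : measurable_fun setT (-%R : measurableTypeR R -> measurableTypeR R) by [].
rewrite -(preimage_setT (-%R : measurableTypeR R -> measurableTypeR R)).
rewrite -(ge0_integral_pushforward mN) //=.
apply: eq_measure_integral => A mA _.
exact: lebesgue_measureN.
Qed.

Lemma ge0_integral_gaussN (f : R -> \bar R) :
  measurable_fun setT f -> (forall x, 0 <= f x) ->
  \int[gauss]_w f (- w)%R = \int[gauss]_w f w.
Proof.
move=> mf f0.
have mpdf : measurable_fun setT (fun x : R => (normal_pdf 0 1 x)%:E).
  by apply/measurable_EFinP; exact: measurable_normal_pdf.
have mN : measurable_fun setT (-%R : measurableTypeR R -> measurableTypeR R) by [].
rewrite ge0_integral_normal //; last exact: measurableT_comp.
rewrite ge0_integral_normal //.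
rewrite -[RHS](@ge0_integral_lebesgueN (fun x => f x * (normal_pdf 0 1 x)%:E)); first last.
- by move=> x; rewrite mule_ge0 // lee_fin normal_pdf_ge0.
- exact: emeasurable_funM.
- apply: eq_integral => x _; congr (_ * _%:E).
  by rewrite !normal_pdfE ?oner_eq0// /normal_fun !subr0 sqrrN.
Qed.

(** The shift formula for the constant 1; it is what makes likelihood ratios martingales. *)
Lemma integral_gauss_expR (h : R) :
  \int[gauss]_w (expR (h * w - h ^+ 2 / 2))%:E = 1.
Proof.
under eq_integral do rewrite -[_%:E]mul1e.
rewrite -(@ge0_integral_gauss_shift h (cst 1)) // (integral_cst gauss) // mul1e.
exact: (probability_setT gauss).
Qed.
Lemma integral_gauss_maxr0 : \int[gauss]_w (Num.max w 0)%:E < +oo.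
Proof.
have mE : measurable_fun setT (fun w : R => expR (1 * w - 1 ^+ 2 / 2)%R).
  by apply: measurableT_comp => //; apply: measurable_funB => //; exact: measurable_funM.
(* Both w and 0 are at most exp(w) = exp(1/2) exp(w - 1/2), and the last factor has mean 1. *)
apply: (@le_lt_trans _ _ ((expR (2^-1))%:E * \int[gauss]_w (expR (1 * w - 1 ^+ 2 / 2))%:E)).
  rewrite -ge0_integralZl_EFin ?expR_ge0 //.
  - apply: ge0_le_integral => //.
    + by move=> w _; rewrite lee_fin le_max lexx orbT.
    + by apply/measurable_EFinP; exact: measurable_maxr.
    + by apply/measurable_EFinP; exact: measurable_funM.
    + move=> w _; rewrite -EFinM lee_fin -expRD.
      rewrite (_ : (_ + _)%R = w); last by field.
      rewrite ge_max expR_ge0 andbT.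
      by rewrite (le_trans _ (expR_ge1Dx w))// lerDr.
  - by apply/measurable_EFinP.
by rewrite integral_gauss_expR mule1 ltry.
Qed.

(** By symmetry: one of w and -w is at most 1, so twice this mass is at least 1. *)
Lemma integral_gauss_le1_gt0 :
  0 < \int[gauss]_w (if (w <= 1)%R then 1 else 0)%:E.
Proof.
have mi : measurable_fun setT (fun w : R => (if (w <= 1)%R then 1 else 0)%:E : \bar R).
  apply/measurable_EFinP; apply: measurable_fun_ifT => //.
  exact: measurable_fun_ler.
have i0 (w : R) : 0 <= (if (w <= 1)%R then 1 else 0 : R)%:E by case: ifP; rewrite lee_fin.
have h : 1 <= \int[gauss]_w (if (w <= 1)%R then 1 else 0)%:E +
              \int[gauss]_w (if (w <= 1)%R then 1 else 0)%:E.
  rewrite -{2}(@ge0_integral_gaussN (fun w => (if (w <= 1)%R then 1 else 0)%:E)) //.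
  rewrite -ge0_integralD //; last first.
    by apply: (measurableT_comp mi) => //; exact: oppr_measurable.
  rewrite -{1}(probability_setT gauss) -[leLHS]mul1e -(integral_cst gauss) //.
  apply: ge0_le_integral => //.
  - apply: emeasurable_funD => //.
    by apply: (measurableT_comp mi) => //; exact: oppr_measurable.
  - move=> w _; rewrite -EFinD lee_fin.
    by case: ifP; case: ifP; lra.
rewrite lt_neqAle integral_ge0 // andbT; apply/eqP => E.
by move: h; rewrite -E adde0 lee_fin ler10.
Qed.
Lemma integral_gaussD (f g : R -> R) :
  measurable_fun setT f -> measurable_fun setT g ->
  (forall w, 0 <= f w)%R -> (forall w, 0 <= g w)%R ->
  \int[gauss]_w (f w + g w)%:E = \int[gauss]_w (f w)%:E + \int[gauss]_w (g w)%:E.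
Proof.
move=> mf mg f0 g0; under eq_integral do rewrite EFinD.
have mfE : measurable_fun setT (fun w => (f w)%:E) by exact/measurable_EFinP.
have mgE : measurable_fun setT (fun w => (g w)%:E) by exact/measurable_EFinP.
by rewrite ge0_integralD // => w _; rewrite lee_fin.
Qed.

Lemma integral_gaussZ (c : R) (f : R -> R) :
  measurable_fun setT f -> (forall w, 0 <= f w)%R -> (0 <= c)%R ->
  \int[gauss]_w (c * f w)%:E = c%:E * \int[gauss]_w (f w)%:E.
Proof.
move=> mf f0 c0; under eq_integral do rewrite EFinM.
have mfE : measurable_fun setT (fun w => (f w)%:E) by exact/measurable_EFinP.
by rewrite ge0_integralZl_EFin // => w _; rewrite lee_fin.
Qed.

Lemma integral_gauss_cst (c : R) : \int[gauss]_w c%:E = c%:E.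
Proof.
rewrite (integral_cst gauss) // -[RHS]mule1; congr (_ * _).
exact: (probability_setT gauss).
Qed.

Lemma le_integral_gauss (f g : R -> R) :
  measurable_fun setT f -> measurable_fun setT g ->
  (forall w, 0 <= f w)%R -> (forall w, f w <= g w)%R ->
  \int[gauss]_w (f w)%:E <= \int[gauss]_w (g w)%:E.
Proof.
move=> mf mg f0 fg.
have mfE : measurable_fun setT (fun w => (f w)%:E) by exact/measurable_EFinP.
have mgE : measurable_fun setT (fun w => (g w)%:E) by exact/measurable_EFinP.
by apply: ge0_le_integral => // w _; rewrite lee_fin.
Qed.

Lemma fin_integral_gauss (f : R -> R) : (forall w, 0 <= f w)%R ->
  \int[gauss]_w (f w)%:E < +oo ->
  exists2 c : R, (0 <= c)%R & \int[gauss]_w (f w)%:E = c%:E.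
Proof.
move=> f0 foo; have f0' : 0 <= \int[gauss]_w (f w)%:E.
  by apply: integral_ge0 => w _; rewrite lee_fin.
exists (fine (\int[gauss]_w (f w)%:E)); first exact: fine_ge0.
by rewrite fineK // ge0_fin_numE.
Qed.

(** * Mean excess and drift of a Gaussian step *)

Definition lower_tail (a w : R) : R := if (w <= a)%R then 1%R else 0%R.
Lemma lower_tail_ge0 a w : (0 <= lower_tail a w)%R. Proof. by rewrite /lower_tail; case: ifP. Qed.
Lemma measurable_lower_tail a : measurable_fun setT (lower_tail a).
Proof. by apply: measurable_fun_ifT => //; exact: measurable_fun_ler. Qed.
#[local] Hint Resolve lower_tail_ge0 measurable_lower_tail : core.

Lemma integral_lower_tail_fin a : exists2 c : R, (0 <= c)%R & \int[gauss]_w (lower_tail a w)%:E = c%:E.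
Proof.
apply: fin_integral_gauss => //.
apply: (@le_lt_trans _ _ (\int[gauss]_w (1 : R)%:E)); last by rewrite integral_gauss_cst ltry.
by apply: le_integral_gauss => // w; rewrite /lower_tail; case: ifP.
Qed.

(** Its integral divided by that of [lower_tail a] is the mean excess E(a - w | w <= a). *)
Definition shortfall (a w : R) : R := Num.max (a - w)%R 0%R.
Lemma shortfall_ge0 a w : (0 <= shortfall a w)%R. Proof. by rewrite /shortfall le_max lexx orbT. Qed.
Lemma measurable_shortfall a : measurable_fun setT (shortfall a).
Proof. by apply: measurable_maxr => //; exact: measurable_funB. Qed.

#[local] Hint Resolve shortfall_ge0 measurable_shortfall : core.

(* The mean excess below a grows with a.  To reduce to a = 1, shift by 1 - a:
   this multiplies the density by an increasing function e, and (1 - w) - K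
   changes sign only at w = 1 - K, where e is compared with its value. *)
Lemma gauss_mean_excess : exists2 K : R, (0 < K)%R & forall a : R, (a <= 1)%R ->
  \int[gauss]_w (shortfall a w)%:E <= K%:E * \int[gauss]_w (lower_tail a w)%:E.
Proof.
have mmax : measurable_fun setT (fun w : R => Num.max w 0%R) by exact: measurable_maxr.
have max0 (w : R) : (0 <= Num.max w 0)%R by rewrite le_max lexx orbT.
have [M M0 ME] := fin_integral_gauss max0 integral_gauss_maxr0.
have mmaxN : measurable_fun setT (fun w : R => Num.max (- w) 0)%R.
  by apply: (measurableT_comp mmax) => //; exact: oppr_measurable.
have ENM : \int[gauss]_w (Num.max (- w) 0)%:E = M%:E.
  by rewrite (@ge0_integral_gaussN (fun w => (Num.max w 0)%:E)) //; exact/measurable_EFinP.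
have [A A0 AE] : exists2 A, (0 <= A)%R & \int[gauss]_w (shortfall 1 w)%:E = A%:E.
  apply: fin_integral_gauss => //.
  apply: (@le_lt_trans _ _ (\int[gauss]_w (1 + Num.max (- w) 0)%:E)).
    apply: le_integral_gauss => //; first exact: measurable_funD.
    move=> w; rewrite /shortfall ge_max addr_ge0 // andbT lerD2l.
    by rewrite le_max lexx.
  by rewrite integral_gaussD // integral_gauss_cst ENM ltry.
have [p p0 pE] := integral_lower_tail_fin 1.
have pgt0 : (0 < p)%R by rewrite -lte_fin -pE; exact: integral_gauss_le1_gt0.
(* [A / p] is the mean excess at a = 1; adding 1 makes the constant positive. *)
exists (A / p + 1)%R; first by rewrite ltr_wpDl // divr_ge0.
move=> a a1; set K := (A / p + 1)%R.
have AK : (A <= K * p)%R by rewrite /K mulrDl divfK ?gt_eqF// mul1r lerDl ltW.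
pose h := (1 - a)%R.
pose e w := expR (h * w - h ^+ 2 / 2).
have e0 w : (0 <= e w)%R by exact: expR_ge0.
have me : measurable_fun setT e.
  by apply: measurableT_comp => //; apply: measurable_funB => //; exact: measurable_funM.
have shift (f : R -> R) : measurable_fun setT f -> (forall w, 0 <= f w)%R ->
    \int[gauss]_w (f (w + h))%:E = \int[gauss]_w (e w * f w)%:E.
  move=> mf f0; rewrite (@ge0_integral_gauss_shift h (fun w => (f w)%:E)) //.
  - by apply: eq_integral => w _; rewrite muleC.
  - exact/measurable_EFinP.
have -> : \int[gauss]_w (shortfall a w)%:E = \int[gauss]_w (e w * shortfall 1 w)%:E.
  rewrite -shift //; apply: eq_integral => w _.
  by rewrite /shortfall /h; congr (Num.max _ _)%:E; ring.
have -> : \int[gauss]_w (lower_tail a w)%:E =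
          \int[gauss]_w (e w * lower_tail 1 w)%:E.
  rewrite -shift //; apply: eq_integral => w _.
  by rewrite /lower_tail /h (_ : (w + (1 - a) <= 1)%R = (w <= a)%R) //; lra.
have meS : measurable_fun setT (fun w => e w * shortfall 1 w)%R by exact: measurable_funM.
have meI : measurable_fun setT (fun w => e w * lower_tail 1 w)%R by exact: measurable_funM.
have eS0 w : (0 <= e w * shortfall 1 w)%R by exact: mulr_ge0.
have eI0 w : (0 <= e w * lower_tail 1 w)%R by exact: mulr_ge0.
have K0 : (0 <= K)%R by rewrite /K addr_ge0 // divr_ge0.
have Ke0 : (0 <= K * e (1 - K))%R by exact: mulr_ge0.
have h0 : (0 <= h)%R by rewrite /h; lra.
(* Integrated form of (e w - e (1 - K)) (1 - w - K) <= 0 for w <= 1, true because [e] is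
   nondecreasing; the terms are arranged so that all integrands are nonnegative. *)
have : \int[gauss]_w (e w * shortfall 1 w + (K * e (1 - K)) * lower_tail 1 w)%:E <=
       \int[gauss]_w (e (1 - K) * shortfall 1 w + K * (e w * lower_tail 1 w))%:E.
  apply: le_integral_gauss => //.
  - by apply: measurable_funD => //; exact: measurable_funM.
  - by apply: measurable_funD; exact: measurable_funM.
  - by move=> w; rewrite addr_ge0 // mulr_ge0.
  - move=> w; rewrite /shortfall /lower_tail; case: ifPn => [w1|].
      rewrite max_l ?subr_ge0 // !mulr1.
      have [wK|wK] := lerP w (1 - K).
        suff : (e w <= e (1 - K))%R by nra.
        by rewrite ler_expR lerD2r ler_wpM2l.
      suff : (e (1 - K) <= e w)%R by nra.
      by rewrite ler_expR lerD2r ler_wpM2l // ltW.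
    rewrite -ltNge => w1; rewrite max_r; last by lra.
    by rewrite !mulr0 !addr0.
rewrite integral_gaussD //; last 2 first.
- exact: measurable_funM.
- by move=> w; rewrite mulr_ge0.
rewrite integral_gaussD //; last 4 first.
- exact: measurable_funM.
- exact: measurable_funM.
- by move=> w; rewrite mulr_ge0.
- by move=> w; rewrite mulr_ge0.
rewrite !integral_gaussZ // pE AE => H.
(* The terms carrying [e (1 - K)] cancel in the right direction because A <= K p. *)
rewrite -(@leeD2rE _ (K * e (1 - K) * p)%:E) //.
apply: (le_trans H); rewrite addeC leeD2l // -EFinM lee_fin.
by rewrite (mulrC K) -mulrA ler_wpM2l.
Qed.
(* One step of a test, with y the distance to the threshold towards which the
   walk drifts: the loss K sigma at the crossing compensates the overshoot. *)
Lemma gauss_drift : exists2 K : R, (0 < K)%R & forall sigma y : R,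
  (0 < sigma <= 1)%R -> (0 < y)%R ->
  \int[gauss]_w (let y' := y - sigma ^+ 2 / 2 + sigma * w in
                 if 0 < y' then y' + K * sigma else 0)%:E + (sigma ^+ 2 / 2)%:E
  <= (y + K * sigma)%:E.
Proof.
have [K K0 KE] := gauss_mean_excess; exists K => // sigma y /andP[s0 s1] y0 /=.
have mmax : measurable_fun setT (fun w : R => Num.max w 0%R) by exact: measurable_maxr.
have max0 (w : R) : (0 <= Num.max w 0)%R by rewrite le_max lexx orbT.
have [M M0 ME] := fin_integral_gauss max0 integral_gauss_maxr0.
have mmaxN : measurable_fun setT (fun w : R => Num.max (- w) 0)%R.
  by apply: (measurableT_comp mmax) => //; exact: oppr_measurable.
have ENM : \int[gauss]_w (Num.max (- w) 0)%:E = M%:E.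
  by rewrite (@ge0_integral_gaussN (fun w => (Num.max w 0)%:E)) //; exact/measurable_EFinP.
(* The noise value at which the walk just reaches the threshold: y' = (w - a) sigma, and a <= sigma
   / 2 <= 1. *)
pose a := ((sigma ^+ 2 / 2 - y) / sigma)%R.
have aE : (a * sigma = sigma ^+ 2 / 2 - y)%R by rewrite divfK ?gt_eqF.
have a1 : (a <= 1)%R by rewrite /a ler_pdivrMr //; nra.
have [p p0 pE] := integral_lower_tail_fin a.
pose f w := (if 0 < y - sigma ^+ 2 / 2 + sigma * w
             then y - sigma ^+ 2 / 2 + sigma * w + K * sigma else 0)%R.
have Ks0 : (0 <= K * sigma)%R by rewrite mulr_ge0 // ltW.
have f0 w : (0 <= f w)%R by rewrite /f; case: ifP => // /ltW; lra.
have mlin : measurable_fun setT (fun w => y - sigma ^+ 2 / 2 + sigma * w)%R.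
  by apply: measurable_funD => //; exact: measurable_funM.
have mf : measurable_fun setT f.
  apply: measurable_fun_ifT => //; first exact: measurable_fun_ltr.
  exact: measurable_funD.
have mZ c (g : R -> R) : measurable_fun setT g -> measurable_fun setT (fun w => c * g w)%R.
  by move=> mg; exact: measurable_funM.
have Z0 c (g : R -> R) : (0 <= c)%R -> (forall w, 0 <= g w)%R -> forall w, (0 <= c * g w)%R.
  by move=> c0 g0 w; exact: mulr_ge0.
have s0' := ltW s0.
have ss0 : (0 <= sigma ^+ 2 / 2)%R by rewrite divr_ge0 // sqr_ge0.
(* The centred noise is split into its positive and negative parts on opposite sides, both of mean
   [M], so that only nonnegative functions are integrated. The shortfall term is the overshoot. *)
have : \int[gauss]_w (f w + (K * sigma) * lower_tail a w + sigma * Num.max (- w) 0)%:E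
       + (sigma ^+ 2 / 2)%:E =
       \int[gauss]_w (y + K * sigma + sigma * shortfall a w + sigma * Num.max w 0)%:E.
  rewrite -integral_gauss_cst -integral_gaussD //; last 2 first.
  - by do !apply: measurable_funD => //; exact: mZ.
  - by move=> w; rewrite !addr_ge0 ?f0 ?mulr_ge0 ?max0 ?lower_tail_ge0 // ltW.
  apply: eq_integral => w _; congr (_%:E).
  have maxE : (Num.max w 0 = w + Num.max (- w) 0)%R.
    have [w0|w0] := ltP 0%R w; last first.
      by rewrite max_l ?oppr_ge0 // subrr.
    by rewrite max_r ?addr0 // oppr_le0 ltW.
  rewrite maxE /f /lower_tail /shortfall.
  have y'E : (y - sigma ^+ 2 / 2 + sigma * w = (w - a) * sigma)%R.
    by rewrite mulrBl aE; ring.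
  rewrite y'E pmulr_lgt0 // subr_gt0; case: ltP => [aw|wa].
    by rewrite (max_r (_ : a - w <= 0)%R) ?subr_le0 ?ltW // -y'E; field.
  rewrite (max_l (_ : 0 <= a - w)%R) ?subr_ge0 //.
  have -> : (sigma * (a - w) = sigma ^+ 2 / 2 - y - sigma * w)%R by rewrite -aE; ring.
  by field.
rewrite !integral_gaussD //; last first.
all: try by move=> w; rewrite ?addr_ge0 ?f0 ?mulr_ge0 ?max0 ?lower_tail_ge0 ?shortfall_ge0 // ltW.
all: try by do ?[apply: measurable_funD => //]; exact: mZ.
rewrite (integral_gauss_cst y) (integral_gauss_cst (K * sigma)%R).
rewrite !integral_gaussZ // ME ENM pE => H.
have SE := KE a a1; rewrite pE in SE.
rewrite -(@leeD2rE _ ((K * sigma)%:E * p%:E + sigma%:E * M%:E)) //.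
rewrite addeAC addeA H -addeA leeD2l // leeD2r //.
rewrite !EFinM muleAC [leRHS]muleC lee_wpmul2l // lee_fin.
Qed.
End Gaussian.

(** * Queries and candidates *)

Section Combinatorics.
Local Open Scope nat_scope.
Variables (n s k : nat).
Hypotheses (s_gt0 : 0 < s) (k_gt0 : 0 < k) (n_gt0 : 0 < n).
Implicit Types (h : history n) (S : {set 'I_n}) (c p : 'I_n).

Lemma grid_point_s_interval (A : {set 'I_n}) : s_interval s A ->
  exists i : 'I_n, exists p : 'I_n,
    [/\ A = [set c : 'I_n | i <= c < i + s], i <= p < i + s & s %| p].
Proof.
case/existsP => i /andP[isn /eqP ->].
(* The largest multiple of [s] not beyond the right end i + s - 1. *)
pose g := (i + s.-1) %/ s * s.
have [ig gi] : i <= g /\ g < i + s.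
  have := divn_eq (i + s.-1) s; have := ltn_pmod (i + s.-1) s_gt0.
  by rewrite /g; split; lia.
have gn : g < n by lia.
exists i, (Ordinal gn); split => //=; first by rewrite ig.
exact: dvdn_mull.
Qed.

Lemma grid_point_uniq (i a b : nat) : i <= a < i + s -> i <= b < i + s ->
  s %| a -> s %| b -> a = b.
Proof. by move=> ia ib /dvdnP[x ax] /dvdnP[y bx]; subst; congr (_ * _); nia. Qed.

(** Each of the [k] disjoint intervals contributes exactly one multiple of [s]; these are the
    coordinates that the search can hit. *)
Lemma card_grid_interval_union S : S \in interval_unions n s k ->
  #|[set c in S | s %| c]| = k.
Proof.
rewrite inE => /existsP[I /and4P[/eqP Ik /forallP intI trI /eqP <-]].
have -> : #|[set c in finset.cover I | s %| c]| =
    \sum_(c in finset.cover I) (s %| c : nat).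
  rewrite -sum1_card big_mkcond [RHS]big_mkcond /=; apply: eq_bigr => c _.
  by rewrite inE; case: (_ \in _); case: (_ %| _).
rewrite finset.big_trivIset //= -Ik -sum1_card; apply: eq_bigr => A AI.
have := intI A; rewrite AI => /grid_point_s_interval [i [p [-> ip sp]]].
rewrite (bigD1 p) ?inE // sp big1 // => c.
rewrite inE => /andP[ic cp]; case: (boolP (s %| c)) => // sc.
by case/eqP: cp; apply/val_inj/(grid_point_uniq ic ip).
Qed.

Lemma search_hits_rcons_search h c b : search_phase k h ->
  search_hits k (rcons h (c, b)) =
  if b then rcons (search_hits k h) c else search_hits k h.
Proof.
rewrite /search_phase /search_hits size_take_min gtn_min ltnn /= => hk.
rewrite filter_rcons /=; case: b => //; rewrite map_rcons.
by rewrite !take_oversize // ?size_rcons // ltnW.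
Qed.

Lemma search_hits_rcons_refinement h c b : ~~ search_phase k h ->
  search_hits k (rcons h (c, b)) = search_hits k h.
Proof.
rewrite /search_phase /search_hits size_take_min gtn_min ltnn -leqNgt /= => hk.
rewrite filter_rcons /=; case: b => //; rewrite map_rcons -cats1 takel_cat //.
Qed.

Lemma search_phase_rcons h c b : search_phase k (rcons h (c, b)) -> search_phase k h.
Proof.
by apply: contraTT => hp; rewrite /search_phase search_hits_rcons_refinement.
Qed.

Lemma size_search_hits h : size (search_hits k h) <= k.
Proof. by rewrite /search_hits size_take_min geq_minl. Qed.

Lemma trivIset_common (I : {set {set 'I_n}}) (A B : {set 'I_n}) c :
  finset.trivIset I -> A \in I -> B \in I -> c \in A -> c \in B -> A = B.
Proof.
move/finset.trivIsetP => tI AI BI cA cB; apply/eqP/negPn/negP => AB.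
by have /pred0P/(_ c) := tI _ _ AI BI AB; rewrite /= cA cB.
Qed.

Lemma consistent_agree h S1 S2 c : consistent h S1 -> consistent h S2 ->
  c \in [seq qa.1 | qa <- h] -> (c \in S1) = (c \in S2).
Proof.
move=> /allP c1 /allP c2 /mapP[qa qah ->].
by rewrite -(eqP (c1 _ qah)) -(eqP (c2 _ qah)).
Qed.

(** Finite-set form of [refinement_query], so that the remaining queries can be counted. *)
Definition refinement_set h : {set 'I_n} :=
  [set c : 'I_n | (c \notin [seq qa.1 | qa <- h]) &&
    [exists p : 'I_n, (p \in search_hits k h) && (c < p < c + s)]].

Lemma refinement_setP h c : reflect (refinement_query s k h c) (c \in refinement_set h).
Proof.
rewrite inE; apply: (iffP andP) => -[ch].
  by move=> /existsP[p /andP[ph cp]]; split => //; exists p.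
by move=> [p ph cp]; split => //; apply/existsP; exists p; rewrite ph.
Qed.

(* Invariant of the runs that obey the rule. *)
Definition orderly h :=
  [/\ search_phase k h ->
        [seq val qa.1 | qa <- h] = [seq i * s | i <- iota 0 (size h)],
      uniq [seq qa.1 | qa <- h] & {in search_hits k h, forall p : 'I_n, s %| p}].

Lemma mem_search_hits h p : p \in search_hits k h -> (p, true) \in h.
Proof.
by move/mem_take/mapP => [[c b]]; rewrite mem_filter /= => /andP[-> ch] ->.
Qed.

Lemma hits_candidate h S : consistent h S -> {subset search_hits k h <= S}.
Proof. by move=> /allP cS p /mem_search_hits /cS /eqP /= <-. Qed.

Lemma uniq_search_hits h : uniq [seq qa.1 | qa <- h] -> uniq (search_hits k h).
Proof. by move=> uh; apply/take_uniq/(subseq_uniq _ uh)/map_subseq/filter_subseq. Qed.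

(** The hits are distinct grid coordinates of [S], and after the search there are [k] of them, as
    many as [S] has; the inclusion is therefore an equality. *)
Lemma search_hits_grid h S : orderly h -> ~~ search_phase k h ->
  S \in candidates s k h -> forall c, (c \in search_hits k h) = (c \in S) && (s %| c).
Proof.
move=> [_ uh gh] ph; rewrite inE => /andP[SC cS] c.
have sub : [set c in search_hits k h] \subset [set c in S | s %| c].
  by apply/fintype.subsetP => p; rewrite !inE => ph'; rewrite (hits_candidate cS) ?gh.
have := subset_leqif_cards sub; rewrite card_grid_interval_union // => -[_ E].
have {E} : [set c in search_hits k h] = [set c in S | s %| c].
  apply/eqP; rewrite -E cardsE (card_uniqP _) ?uniq_search_hits //.
  by rewrite eqn_leq size_search_hits leqNgt.
by move/setP/(_ c); rewrite !inE.
Qed.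

(** If the grid were exhausted with fewer than [k] hits, a candidate would have had all its [k] grid
    coordinates answered 1; so no candidate would be left and the procedure would have stopped. *)
Lemma orderly_search h : orderly h -> search_phase k h -> ~~ stopped s k h ->
  size h * s < n.
Proof.
move=> [mapE _ _] ph; apply: contraNT; rewrite -leqNgt => nh.
have h0 : 0 < size h by case: (size h) nh => //; lia.
rewrite /stopped h0 /=; apply: leq_trans (leq0n 1); rewrite leqn0 cards_eq0.
apply/eqP/finset.setP => S; rewrite finset.in_set0; apply/negP; rewrite inE => /andP[SC cS].
have := card_grid_interval_union SC; apply/eqP; rewrite neq_ltn; apply/orP; left.
have := ph; rewrite /search_phase /search_hits size_take_min gtn_min ltnn /=.
apply: leq_ltn_trans; apply: leq_trans (card_size _); apply/subset_leq_card/fintype.subsetP => c.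
rewrite !inE => /andP[cinS /dvdnP[a ca]].
have : val c \in [seq val qa.1 | qa <- h].
  rewrite mapE //; apply/mapP; exists a => //; rewrite mem_iota /= add0n.
  by have := ltn_ord c; nia.
move=> /mapP[qa qah /val_inj cE]; apply/mapP; exists qa => //.
by rewrite mem_filter qah andbT (eqP (allP cS _ qah)) -cE.
Qed.

(** * Uniqueness of the candidate after the refinement *)

Section UniqueCandidate.
Variable h : history n.
Hypotheses (oh : orderly h) (ph : ~~ search_phase k h) (rh : refinement_set h = finset.set0).

Let admissible (I : {set {set 'I_n}}) :=
  [/\ {in I, forall A, s_interval s A}, finset.trivIset I &
      finset.cover I \in candidates s k h].

Let consistent_cover I : admissible I -> consistent h (finset.cover I).
Proof. by case=> _ _; rewrite inE => /andP[]. Qed.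

Let hit_cover I p : admissible I -> p \in finset.cover I -> s %| p -> p \in search_hits k h.
Proof. by case=> _ _ cI pI sp; rewrite (search_hits_grid oh ph cI) pI sp. Qed.

(** The hit itself was answered in the search, and the coordinates of the window to its left because
    no refinement query is left. *)
Let answered p c : p \in search_hits k h -> c <= p < c + s -> c \in [seq qa.1 | qa <- h].
Proof.
move=> pH; rewrite leq_eqVlt => /andP[/predU1P[/val_inj ->|cp] pc].
  by apply/mapP; exists (p, true) => //; exact: mem_search_hits.
apply/negPn/negP => ch.
have : c \in refinement_set h by apply/refinement_setP; split=> //; exists p; rewrite ?cp.
by rewrite rh inE.
Qed.

(* Induction from left to right on the grid point p of A.  If the interval of I2
   containing p differed from A, the smaller of the two left endpoints would be
   an answered coordinate, hence covered in both families, and in one of them by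
   an interval further to the left, on which both families agree. *)
Lemma admissible_sub m I1 I2 (A : {set 'I_n}) p : admissible I1 -> admissible I2 ->
  A \in I1 -> p \in A -> s %| p -> p < m -> A \in I2.
Proof.
(* Both families are generalized: one case below passes from [I2] to [I1] by induction, the other
   from [I1] to [I2]. *)
elim: m I1 I2 A p => // m IH I1 I2 A p a1 a2 AI pA sp pm.
have [int1 tr1 _] := a1; have [int2 tr2 _] := a2.
have in1 B c : B \in I1 -> c \in B -> c \in finset.cover I1.
  by move=> BI cB; apply/bigcupP; exists B.
have in2 B c : B \in I2 -> c \in B -> c \in finset.cover I2.
  by move=> BI cB; apply/bigcupP; exists B.
have agree c : c \in [seq qa.1 | qa <- h] -> (c \in finset.cover I1) = (c \in finset.cover I2).
  exact: consistent_agree (consistent_cover a1) (consistent_cover a2).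
have pH := hit_cover a1 (in1 _ _ AI pA) sp.
have /bigcupP[A2 A2I pA2] : p \in finset.cover I2.
  exact: (hits_candidate (consistent_cover a2)).
have [i1 [_ [A1E _ _]]] := grid_point_s_interval (int1 _ AI).
have [i2 [_ [A2E _ _]]] := grid_point_s_interval (int2 _ A2I).
have := pA; have := pA2; rewrite {1}A1E {1}A2E !inE => pi2 pi1.
have [i12|i12|i12] := ltngtP i1 i2.
- have i1A : i1 \in A by rewrite A1E inE; clear -s_gt0; lia.
  have : i1 \in finset.cover I2 by rewrite -agree ?(in1 A) //; apply: (answered pH); clear -pi1 pi2 i12; lia.
  case/bigcupP => B BI i1B.
  have [i3 [r [BE ir sr]]] := grid_point_s_interval (int2 _ BI).
  have i13 : i3 <= i1 < i3 + s by move: i1B; rewrite {1}BE inE.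
  have pB : p \notin B.
    apply/negP => pB; have BA2 := trivIset_common tr2 BI A2I pB pA2.
    by move: i1B; rewrite BA2 A2E inE leqNgt i12.
  have rp : r < p.
    by rewrite ltnNge; apply: contra pB => pr; rewrite BE inE; clear -pr ir i13 pi1 pi2; lia.
  have rB : r \in B by rewrite BE inE.
  have BI1 : B \in I1 by apply: (IH I2 I1 B r) => //; exact: leq_trans rp pm.
  by move: pB; rewrite -(trivIset_common tr1 AI BI1 i1A i1B) pA.
- have i2A : i2 \in A2 by rewrite A2E inE; clear -s_gt0; lia.
  have : i2 \in finset.cover I1 by rewrite agree ?(in2 A2) //; apply: (answered pH); clear -pi1 pi2 i12; lia.
  case/bigcupP => B BI i2B.
  have [i3 [r [BE ir sr]]] := grid_point_s_interval (int1 _ BI).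
  have i23 : i3 <= i2 < i3 + s by move: i2B; rewrite {1}BE inE.
  have pB : p \notin B.
    apply/negP => pB; have BA := trivIset_common tr1 BI AI pB pA.
    by move: i2B; rewrite BA A1E inE leqNgt i12.
  have rp : r < p.
    by rewrite ltnNge; apply: contra pB => pr; rewrite BE inE; clear -pr ir i23 pi1 pi2; lia.
  have rB : r \in B by rewrite BE inE.
  have BI2 : B \in I2 by apply: (IH I1 I2 B r) => //; exact: leq_trans rp pm.
  by move: pB; rewrite -(trivIset_common tr2 A2I BI2 i2A i2B) pA2.
- by rewrite A1E i12 -A2E.
Qed.

Lemma candidates_le1 : #|candidates s k h| <= 1.
Proof.
apply/card_le1_eqP => S1 S2 S1c S2c.
have adm S : S \in candidates s k h -> exists2 I, admissible I & finset.cover I = S.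
  move=> Sc; have := Sc; rewrite inE => /andP[+ _].
  rewrite inE => /existsP[I /and4P[_ /forallP intI trI /eqP E]]; exists I => //.
  by split => //; [move=> A AI; have := intI A; rewrite AI|rewrite E].
have [I1 a1 <-] := adm _ S1c; have [I2 a2 <-] := adm _ S2c.
have sub I J : admissible I -> admissible J -> I \subset J.
  move=> aI aJ; apply/fintype.subsetP => A AI; have [int _ _] := aI.
  have [i [p [AE ip sp]]] := grid_point_s_interval (int _ AI).
  by apply: (@admissible_sub p.+1 I J A p) => //; rewrite AE inE.
by congr finset.cover; apply/eqP; rewrite finset.eqEsubset !sub.
Qed.

End UniqueCandidate.

(** By contraposition: with no refinement query left, at most one candidate remains. Hence the rule
    prescribes a proper query throughout the refinement phase. *)
Lemma orderly_refinement h : orderly h -> ~~ search_phase k h -> ~~ stopped s k h ->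
  exists c, refinement_query s k h c.
Proof.
move=> oh ph; apply: contraNP => no_query.
(* [stopped] requires a first answer; the empty history is still in the search phase because k >
   0. *)
have h0 : 0 < size h.
  case: h ph {oh no_query} => //; rewrite /search_phase /search_hits /= k_gt0 //.
rewrite /stopped h0 candidates_le1 //; apply/finset.setP => c; rewrite finset.in_set0; apply/negbTE/negP.
by move/refinement_setP => cq; apply: no_query; exists c.
Qed.

(** * Runs that obey the query rule *)

Section Rule.
Variable q : history n -> 'I_n.
Hypothesis rule : search_refinement_rule s k q.

Lemma orderly_search_query h : orderly h -> search_phase k h -> ~~ stopped s k h ->
  q h = size h * s :> nat.
Proof. by move=> oh ph nh; have := rule nh; rewrite ph; apply; exact: orderly_search. Qed.

Lemma orderly_refinement_query h : orderly h -> ~~ search_phase k h ->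
  ~~ stopped s k h -> q h \in refinement_set h.
Proof.
move=> oh ph nh; apply/refinement_setP; have := rule nh; rewrite (negPf ph); apply.
exact: orderly_refinement.
Qed.

Lemma query_new h : orderly h -> ~~ stopped s k h -> q h \notin [seq qa.1 | qa <- h].
Proof.
move=> oh nh; have [ph|ph] := boolP (search_phase k h); last first.
  by have := orderly_refinement_query oh ph nh; rewrite inE => /andP[].
have [mapE _ _] := oh; apply/negP => qh.
have : val (q h) \in [seq val qa.1 | qa <- h] by rewrite (map_comp val) map_f.
rewrite mapE //= orderly_search_query // => /mapP[i]; rewrite mem_iota add0n /=.
by move=> il /eqP; rewrite eqn_pmul2r // => /eqP E; rewrite -E ltnn in il.
Qed.

Lemma orderly_rcons h b : orderly h -> ~~ stopped s k h -> orderly (rcons h (q h, b)).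
Proof.
move=> oh nh; have [mapE uh gh] := oh; split.
- move=> ph'; have ph := search_phase_rcons ph'.
  by rewrite map_rcons mapE //= orderly_search_query // size_rcons -addn1 iotaD map_cat cats1.
- by rewrite map_rcons rcons_uniq query_new.
- have [ph|ph] := boolP (search_phase k h); last by rewrite search_hits_rcons_refinement.
  rewrite search_hits_rcons_search //; case: b => // p.
  rewrite mem_rcons inE => /predU1P[->|/gh//].
  by rewrite orderly_search_query // dvdn_mull.
Qed.

Lemma orderly_nil : orderly [::].
Proof. by []. Qed.

Lemma card_left_window p : #|[set c : 'I_n | c < p < c + s]| <= s.-1.
Proof.
rewrite cardE -(size_map val) -[leqRHS](size_iota (p - s.-1)).
apply: uniq_leq_size; first by rewrite (map_inj_uniq val_inj) enum_uniq.
move=> x /mapP[c]; rewrite mem_enum inE => cp ->{x}; rewrite mem_iota /=.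
by clear -cp; lia.
Qed.

Lemma card_refinement_set h : #|refinement_set h| <= k * s.-1.
Proof.
apply: (@leq_trans (\sum_(p <- search_hits k h) s.-1)); last first.
  by rewrite big_const_seq count_predT iter_addn_0 mulnC leq_mul2r size_search_hits orbT.
have sub : refinement_set h \subset
    \big[@finset.setU _/finset.set0]_(p <- search_hits k h) [set c : 'I_n | c < p < c + s].
  apply/fintype.subsetP => c; rewrite inE => /andP[_ /existsP[p /andP[ph cp]]].
  by rewrite (big_rem p) //= !inE cp.
apply: leq_trans (subset_leq_card sub) _.
elim: (search_hits k h) => [|p l IH]; first by rewrite !big_nil cards0.
rewrite !big_cons; apply: leq_trans (leq_card_setU _ _) _.
by apply: leq_add => //; exact: card_left_window.
Qed.

Local Open Scope ring_scope.

(** * Total cost of the queries still possible *)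

Section Budget.
Variables (R : realDomainType) (c : bool -> R) (cref : R) (S : {set 'I_n}).
Hypotheses (c_ge0 : forall b, 0 <= c b) (cref_ge0 : 0 <= cref).

Definition query_cost h := if search_phase k h then c (q h \in S) else cref.

(** Each unvisited grid coordinate is charged by its true membership in [S], and during the search k
    (s - 1) refinement queries are held in reserve. The costs are later instantiated by precisions
    and by error probabilities. *)
Definition remaining_cost h :=
  if search_phase k h then
    \sum_(x : 'I_n | (s %| x)%N && (size h * s <= x)%N) c (x \in S) + (k * s.-1)%:R * cref
  else #|refinement_set h|%:R * cref.

Lemma remaining_cost_ge0 h : 0 <= remaining_cost h.
Proof.
rewrite /remaining_cost; case: ifP => _; last exact: mulr_ge0.
by rewrite addr_ge0 ?mulr_ge0 // sumr_ge0.
Qed.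

(** Whatever the answer, a search query removes its own term from the grid sum, and a refinement
    query removes one element of [refinement_set]. *)
Lemma remaining_cost_rcons h b : orderly h -> ~~ stopped s k h ->
  query_cost h + remaining_cost (rcons h (q h, b)) <= remaining_cost h.
Proof.
move=> oh nh; rewrite /query_cost /remaining_cost.
have [ph|ph] := boolP (search_phase k h); last first.
  have -> : search_phase k (rcons h (q h, b)) = false.
    by apply/negbTE; apply: contra ph; exact: search_phase_rcons.
  have qr := orderly_refinement_query oh ph nh.
  have -> : refinement_set (rcons h (q h, b)) = refinement_set h :\ q h.
    apply/finset.setP => x; rewrite !inE search_hits_rcons_refinement // map_rcons mem_rcons inE.
    by rewrite negb_or andbA.
  by rewrite [in X in _ <= X](cardsD1 (q h)) qr natrD mulrDl mul1r.
have qE := orderly_search_query oh ph nh.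
rewrite [in X in _ <= X](bigD1 (q h)) /=; last by rewrite qE dvdn_mull /=.
(* If this answer ends the search, the remaining grid terms are dropped and the reserve covers the
   refinement set. *)
rewrite -addrA lerD2l; case: ifP => _; last first.
  by rewrite ler_wpDl ?sumr_ge0 // ler_wpM2r // ler_nat card_refinement_set.
rewrite lerD2r le_eqVlt; apply/orP; left; apply/eqP/eq_bigl => x.
rewrite size_rcons -andbA; case sx : (s %| x)%N => //=.
case/dvdnP: sx => a xa; rewrite -(inj_eq val_inj) /= qE xa leq_pmul2r // leq_pmul2r //.
by rewrite eqn_pmul2r // ltn_neqAle eq_sym andbC.
Qed.

End Budget.

Lemma card_grid : (s %| n)%N -> #|[set x : 'I_n | (s %| x)%N]| = (n %/ s)%N.
Proof.
move=> sn; rewrite -[RHS](card_ord (n %/ s)).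
have lt_n (g : 'I_(n %/ s)) : (g * s < n)%N by rewrite -ltn_divRL.
pose f g : 'I_n := Ordinal (lt_n g).
have f_inj : injective f.
  by move=> a b /(congr1 val) /= /eqP; rewrite eqn_pmul2r // => /eqP /val_inj.
rewrite -(card_codom f_inj); apply: eq_card => x; rewrite inE.
apply/idP/codomP => [/dvdnP[g xg]|[g ->]]; last exact: dvdn_mull.
have gl : (g < n %/ s)%N by rewrite ltn_divRL // -xg.
by exists (Ordinal gl); apply/val_inj.
Qed.

(** The grid has n / s coordinates, [k] of which lie in [S]. *)
Lemma remaining_cost_nil (R : realDomainType) (c : bool -> R) (cref : R) S :
  (s %| n)%N -> S \in interval_unions n s k ->
  remaining_cost c cref S [::] =
  (n %/ s - k)%:R * c false + k%:R * c true + (k * s.-1)%:R * cref.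
Proof.
move=> sn SC; rewrite /remaining_cost /search_phase /= k_gt0; congr (_ + _).
under eq_bigl do rewrite mul0n leq0n andbT.
have gridS : #|[set x in S | (s %| x)%N]| = k by exact: card_grid_interval_union.
have gridE : #|[set x : 'I_n | (s %| x)%N] :\: S| = (n %/ s - k)%N.
  rewrite -(card_grid sn) -gridS cardsD; congr (_ - _)%N.
  by apply: eq_card => x; rewrite !inE andbC.
rewrite (bigID (mem S)) /= addrC; congr (_ + _).
  rewrite -gridE mulr_natl -sumr_const; apply: eq_big => x.
    by rewrite !inE andbC.
  by move=> /andP[_ /negbTE ->].
rewrite -[in RHS]gridS mulr_natl -sumr_const; apply: eq_big => x.
  by rewrite !inE andbC.
by move=> /andP[_ ->].
Qed.

End Rule.

End Combinatorics.

(** * Markov chains driven by Gaussian noise *)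

Section Chain.
Import numFieldNormedType.Exports.
Local Open Scope classical_set_scope.
Context {R : realType}.
Notation gauss := (@normal_prob R 0 1).
Variables (H : countType) (step : H * R -> R -> H * R) (x0 : H * R).

(* The histories are countable; coding them by numbers puts the chain in the
   measurable space nat * R. *)
Definition encode (x : H * R) : nat * R := (pickle x.1, x.2).

Fixpoint chain (w : nat -> R) (j : nat) : H * R :=
  if j is i.+1 then step (chain w i) (w i) else x0.

(** Numbers that code no history get the default [u0]; the chain never visits them. *)
Definition decoded (U : Type) (u0 : U) (f : H * R -> R -> U) (p : (nat * R) * R) : U :=
  if unpickle p.1.1 is Some h then f (h, p.1.2) p.2 else u0.

Lemma decodedE (U : Type) (u0 : U) (f : H * R -> R -> U) x w :
  decoded u0 f (encode x, w) = f x w.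
Proof. by rewrite /decoded /= pickleK; case: x. Qed.

(** There are countably many codes: the preimage is a countable union of slices on which the history
    is fixed. *)
Lemma measurable_decoded d (U : measurableType d) (u0 : U) (f : H * R -> R -> U) :
  (forall h, measurable_fun setT (fun p : R * R => f (h, p.1) p.2)) ->
  measurable_fun setT (decoded u0 f).
Proof.
move=> mf _ B mB; rewrite setTI.
pose proj (p : (nat * R) * R) : R * R := (p.1.2, p.2).
have mproj : measurable_fun setT proj.
  apply: measurable_fun_pair; last exact: measurable_snd.
  exact: measurableT_comp measurable_snd measurable_fst.
have mcode : measurable_fun setT (fun p : (nat * R) * R => p.1.1).
  exact: measurableT_comp measurable_fst measurable_fst.
pose slice m : set ((nat * R) * R) := if unpickle m is Some h
  then proj @^-1` ((fun p : R * R => f (h, p.1) p.2) @^-1` B)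
  else (fun=> u0) @^-1` B.
have -> : decoded u0 f @^-1` B =
    \bigcup_m ((fun p : (nat * R) * R => p.1.1) @^-1` [set m] `&` slice m).
  apply/seteqP; split => [p Bp|p [m _ [/= <-]]].
    by exists p.1.1 => //; split => //; move: Bp; rewrite /slice /decoded /=; case: unpickle.
  by rewrite /slice /decoded; case: unpickle.
apply: bigcupT_measurable => m; apply: measurableI.
  by rewrite -[X in measurable X]setTI; exact: mcode.
rewrite /slice; case: unpickle => [h|].
  rewrite -[X in measurable X]setTI; apply: mproj => //.
  by rewrite -[X in measurable X]setTI; exact: mf.
by rewrite -[X in measurable X]setTI; exact: measurable_cst.
Qed.

Hypothesis mstep : forall h, measurable_fun setT (fun p : R * R => encode (step (h, p.1) p.2)).

(** Only the first [j] noises are assumed measurable, so that [T] may carry the sigma-algebra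
    generated by them. *)
Lemma measurable_chain d (T : measurableType d) (W : nat -> T -> R) j :
  (forall i, (i < j)%N -> measurable_fun setT (W i)) ->
  measurable_fun setT (fun omega => encode (chain (W ^~ omega) j)).
Proof.
elim: j => [|j IH] mW //=.
have -> : (fun omega => encode (step (chain (W^~ omega) j) (W j omega))) =
    decoded (0%N, 0) (fun x w => encode (step x w)) \o
      (fun omega => (encode (chain (W ^~ omega) j), W j omega)).
  by apply/funext => omega; rewrite /comp decodedE.
apply: measurableT_comp; first exact: measurable_decoded.
by apply: measurable_fun_pair; [apply: IH => i ij; apply: mW; exact: ltnW|exact: mW].
Qed.

(** * Independence of the chain and the next noise *)

Section Law.
Local Open Scope ereal_scope.
Context d (T : measurableType d) (P : probability T R) (W : nat -> {RV P >-> R}).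
Hypothesis W_iid : iid_standard_normal W.

Let X j omega := chain (fun i => W i omega) j.

Let measurable_X j : measurable_fun setT (fun omega => encode (X j omega)).
Proof. by apply: (@measurable_chain _ _ (fun i => W i : T -> R)) => i _; exact: measurable_funPT. Qed.

(* A pi-system generating the sigma-algebra of the first j noises. *)
Let past j : set_system T := [set A | exists2 B : nat -> set R,
  forall i, measurable (B i) & A = \big[setI/setT]_(i <- iota 0 j) (W i @^-1` B i)].

Let measurable_W_preimage i (B : set R) : measurable B -> measurable (W i @^-1` B).
Proof. by move=> mB; rewrite -[X in measurable X]setTI; exact: measurable_funPT. Qed.

Let past_measurable j : past j `<=` measurable.
Proof.
move=> A [B mB ->]; elim/big_ind: _ => //; first exact: measurableI.
by move=> i _; exact: measurable_W_preimage.
Qed.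

Let past_setI j : setI_closed (past j).
Proof.
move=> A1 A2 [B1 mB1 ->] [B2 mB2 ->]; exists (fun i => B1 i `&` B2 i).
  by move=> i; exact: measurableI.
by rewrite -big_split.
Qed.

Let past_setT j : past j setT.
Proof. by exists (fun=> setT) => //; rewrite big1. Qed.

(** Both sides are finite measures in [A] that agree on the pi-system [past j], hence on the
    sigma-algebra it generates. *)
Let past_indep j (B : set R) A : measurable B -> <<s past j >> A ->
  P (A `&` W j @^-1` B) = P A * P (W j @^-1` B).
Proof.
move=> mB; set E := W j @^-1` B.
have mE : measurable E by exact: measurable_W_preimage.
pose r : {nonneg R} := NngNum (fine_ge0 (measure_ge0 P E)).
have rE : r%:num%:E = P E by rewrite /= fineK // fin_num_measure.
move=> sA; rewrite [RHS]muleC -rE.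
apply: (@g_sigma_algebra_measure_unique _ R T (past j) (@past_measurable j) (fun=> setT)
  (fun=> past_setT j) _ (mrestr P mE) (mscale r P)) => //.
- by rewrite bigcup_const //; exists 0%N.
- move=> _ [C mC ->]; transitivity (P (\big[setI/setT]_(i <- iota 0 j) (W i @^-1` C i)) * P E).
    (* Placing [B] at index [j] turns the claim into mutual independence of the noises 0, ..., j. *)
    pose C' i := if i == j then B else C i.
    have mC' i : measurable (C' i) by rewrite /C'; case: ifP.
    have uj : uniq (iota 0 j ++ [:: j]) by rewrite cats1 rcons_uniq iota_uniq mem_iota add0n ltnn.
    have E1 : {in iota 0 j, forall i, C' i = C i}.
      move=> i; rewrite mem_iota /= add0n /C' => ij.
      by rewrite (_ : (i == j) = false) // ltn_eqF.
    have CE (V : Type) (idx : V) (op : Monoid.law idx) (F : set R -> nat -> V) :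
        \big[op/idx]_(i <- iota 0 j) F (C' i) i = \big[op/idx]_(i <- iota 0 j) F (C i) i.
      by apply: eq_big_seq => i ij; rewrite E1.
    have := W_iid.1 _ C' uj mC'; have := W_iid.1 _ C (iota_uniq 0 j) mC => PC.
    rewrite !big_cat !big_seq1 /= {2}/C' {3}/C' eqxx.
    rewrite (CE _ _ _ (fun B i => W i @^-1` B)) (CE _ _ _ (fun B i => P (W i @^-1` B))).
    by rewrite -PC.
  by rewrite muleC -rE.
- move=> _; apply: (@le_lt_trans _ _ (P setT)); last by rewrite probability_setT ltry.
  by apply: le_measure; rewrite ?inE //; exact: measurableI.
Qed.

(** The state after [j] steps depends only on the noises with index below [j]. *)
Lemma chain_noise_independent j (A : set (nat * R)) (B : set R) :
  measurable A -> measurable B ->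
  P ((fun omega => encode (X j omega)) @^-1` A `&` W j @^-1` B) =
  P ((fun omega => encode (X j omega)) @^-1` A) * P (W j @^-1` B).
Proof.
move=> mA mB; apply: past_indep => //.
pose T' := g_sigma_algebraType (past j).
have mW i : (i < j)%N -> measurable_fun setT (W i : T' -> R).
  move=> ij _ B' mB'; rewrite setTI; apply: sub_sigma_algebra.
  (* A condition on one noise is a cylinder whose other factors are the whole line. *)
  exists (fun l => if l == i then B' else setT); first by move=> l; case: ifP.
  rewrite (bigD1_seq i) ?iota_uniq ?mem_iota //= eqxx big1 ?setIT // => l /negbTE ->.
  exact: preimage_setT.
have := @measurable_chain _ T' (fun i => W i : T' -> R) j mW.
move=> /(_ measurableT A mA); rewrite setTI; exact.
Qed.

Let integral_noise j (f : R -> \bar R) : measurable_fun setT f -> (forall w, 0 <= f w) ->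
  \int[distribution P (W j)]_w f w = \int[gauss]_w f w.
Proof.
move=> mf f0; rewrite ge0_integral_distribution //.
have mW0 : measurable_fun setT (W j) by exact: measurable_funPT.
have mW : @measurable_fun _ _ T (measurableTypeR R) setT (W j) := mW0.
rewrite -[LHS](ge0_integral_pushforward mW P measurableT mf) //.
by apply: eq_measure_integral => A mA _; exact: W_iid.2.
Qed.

Let measurable_section (G : H * R -> R -> \bar R) x :
  (forall h, measurable_fun setT (fun p : R * R => G (h, p.1) p.2)) ->
  measurable_fun setT (G x).
Proof.
case: x => h z mG; exact: (measurableT_comp (mG h) (pair1_measurable z)).
Qed.

(** By independence the joint law is a product, and Tonelli integrates out the noise first; this
    plays the role of conditioning on the state. *)
Lemma ge0_integral_chain (G : H * R -> R -> \bar R) j :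
  (forall h, measurable_fun setT (fun p : R * R => G (h, p.1) p.2)) ->
  (forall x w, 0 <= G x w) ->
  \int[P]_omega G (X j omega) (W j omega) =
  \int[P]_omega \int[gauss]_w G (X j omega) w.
Proof.
move=> mG G0.
pose Y omega := encode (X j omega); pose g := decoded 0 G.
have mY : measurable_fun setT Y by exact: measurable_X.
have mg : measurable_fun setT g by exact: measurable_decoded.
have g0 p : 0 <= g p by rewrite /g /decoded; case: unpickle.
pose Ym : {mfun T >-> (nat * R)%type} := mfun_Sub (mem_set mY).
have mYW : measurable_fun setT (fun omega => (Y omega, W j omega)).
  by apply: measurable_fun_pair => //; exact: measurable_funPT.
pose YWm : {mfun T >-> ((nat * R) * R)%type} := mfun_Sub (mem_set mYW).
transitivity (\int[distribution P YWm]_p g p).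
  rewrite ge0_integral_distribution //; apply: eq_integral => omega _.
  exact/esym/decodedE.
transitivity (\int[(distribution P Ym \x distribution P (W j))%E]_p g p).
  apply: eq_measure_integral => A mA _; apply/esym/product_measure_unique => // B C mB mC.
  exact: chain_noise_independent.
rewrite fubini_tonelli1 // ge0_integral_distribution //.
- apply: eq_integral => omega _; rewrite -(@integral_noise j) //; last exact: measurable_section.
  by apply: eq_integral => w _; exact: decodedE.
- exact: measurable_fun_fubini_tonelli_F.
- by move=> y; exact: integral_ge0.
Qed.

Lemma measurable_integral_chain (G : H * R -> R -> \bar R) j :
  (forall h, measurable_fun setT (fun p : R * R => G (h, p.1) p.2)) ->
  (forall x w, 0 <= G x w) ->
  measurable_fun setT (fun omega => \int[gauss]_w G (X j omega) w).
Proof.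
move=> mG G0; pose g := decoded 0 G.
have mg : measurable_fun setT g by exact: measurable_decoded.
have g0 p : 0 <= g p by rewrite /g /decoded; case: unpickle.
have := measurableT_comp
  (measurable_fun_fubini_tonelli_F (m2 := distribution P (W j)) g mg g0) (@measurable_X j).
congr measurable_fun; apply/funext => omega; rewrite /= /fubini_F -(@integral_noise j) //.
  by apply: eq_integral => w _; exact: decodedE.
exact: measurable_section.
Qed.

Lemma measurable_fun_encoded d' (U : measurableType d') (F : H * R -> \bar R) (x : U -> H * R) :
  (forall h, measurable_fun setT (fun z : R => F (h, z))) ->
  measurable_fun setT (fun u => encode (x u)) ->
  measurable_fun setT (fun u => F (x u)).
Proof.
move=> mF mx; pose G (y : H * R) (w : R) := F y.
have mG h : measurable_fun setT (fun p : R * R => G (h, p.1) p.2).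
  exact: (measurableT_comp (mF h) measurable_fst).
have mp : measurable_fun setT (fun u => (encode (x u), 0%R : R)).
  by apply: measurable_fun_pair.
have := measurableT_comp (measurable_decoded 0 mG) mp.
by congr measurable_fun; apply/funext => u; rewrite /= decodedE.
Qed.

Lemma measurable_chain_pred (Q : pred H) j : measurable [set omega | Q (X j omega).1].
Proof.
have mQ : measurable [set p : nat * R | if unpickle p.1 is Some h then Q h else false].
  rewrite (_ : [set p | _] =
    fst @^-1` [set m : nat | if unpickle m is Some h then Q h else false]) //.
  by rewrite -[X in measurable X]setTI; exact: measurable_fst.
have := @measurable_X j measurableT _ mQ; rewrite setTI.
by congr measurable; apply/seteqP; split => omega /=; rewrite pickleK.
Qed.

(** * Nonnegative potentials decreasing along the chain *)

Section Potential.
Variables (halts : pred H) (inv : H * R -> Prop) (kappa : R) (F : H * R -> \bar R).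
Hypotheses (step_halts : forall x w, halts x.1 -> step x w = x)
  (inv0 : inv x0) (invS : forall x w, inv x -> ~~ halts x.1 -> inv (step x w))
  (kappa_ge0 : (0 <= kappa)%R) (F_ge0 : forall x, 0 <= F x)
  (measurable_F : forall h, measurable_fun setT (fun z : R => F (h, z)))
  (F_decreases : forall x, inv x -> ~~ halts x.1 ->
     kappa%:E + \int[gauss]_w F (step x w) <= F x).

Lemma chain_invariant w j : inv (chain w j).
Proof.
elim: j => [|j IH] //=; have [hj|hj] := boolP (halts (chain w j).1).
  by rewrite step_halts.
exact: invS.
Qed.

(** Telescopes the one-step inequality, [kappa] being the cost of a step before halting. It is
    applied with kappa = Gamma to count precision and with kappa = 0 to bound errors. *)
Lemma potential_bound J :
  \sum_(0 <= j < J) \int[P]_omega (if halts (X j omega).1 then 0 else kappa%:E) +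
  \int[P]_omega F (X J omega) <= F x0.
Proof.
have cost0 j omega : 0 <= (if halts (X j omega).1 then 0 else kappa%:E).
  by case: ifP => // _; rewrite lee_fin.
elim: J => [|J IH].
  rewrite big_geq // add0e /X /= (integral_cst P) // -[leRHS]mule1.
  by rewrite lee_wpmul2l // probability_le1.
apply: le_trans IH; rewrite big_nat_recr //= -addeA leeD2l //.
have mG h : measurable_fun setT (fun p : R * R => F (step (h, p.1) p.2)).
  exact: measurable_fun_encoded.
rewrite (@ge0_integral_chain (fun x w => F (step x w))) //.
have mcost : measurable_fun setT (fun omega => if halts (X J omega).1 then 0 else kappa%:E).
  apply: measurable_fun_ifT => //.
  apply: (measurable_fun_bool true); rewrite setTI.
  exact: (measurable_chain_pred halts J).
have mint := @measurable_integral_chain (fun x w => F (step x w)) J mG (fun x w => F_ge0 _).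
rewrite -ge0_integralD //; last by move=> omega _; exact: integral_ge0.
apply: ge0_le_integral => //.
- by move=> omega _; rewrite adde_ge0 // integral_ge0.
- exact: emeasurable_funD.
- exact: measurable_fun_encoded.
- move=> omega _; have [hJ|hJ] := boolP (halts (X J omega).1); last first.
    by apply: F_decreases => //; exact: chain_invariant.
  (* A halted state is fixed, so its potential is preserved at no cost. *)
  under eq_integral do rewrite step_halts //.
  by rewrite add0e (integral_cst gauss) // -[leRHS]mule1 lee_wpmul2l // probability_le1.
Qed.

End Potential.

End Law.
End Chain.

(** * The sequential tests *)

Section SPRT.
Import numFieldNormedType.Exports.
Context {R : realType}.
Notation gauss := (@normal_prob R 0 1).

Lemma log_likelihood_ratioE (mu Gamma y : R) : 0 < Gamma ->
  log_likelihood_ratio mu Gamma y = Gamma * (mu * y - mu ^+ 2 / 2).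
Proof.
move=> G0; rewrite /log_likelihood_ratio.
have s0 : Num.sqrt Gamma^-1 != 0 by rewrite gt_eqF // sqrtr_gt0 invr_gt0.
rewrite !normal_pdfE // /normal_fun sqr_sqrtr ?invr_ge0 ?ltW //.
rewrite -mulf_div divff ?mul1r ?gt_eqF ?normal_peak_gt0 // -expRB expRK.
by field; rewrite gt_eqF.
Qed.

Variables (n s k : nat) (delta mu Gamma : R) (q : history n -> 'I_n) (S : {set 'I_n}).
Implicit Types (h : history n).
Hypotheses (n_gt0 : (0 < n)%N) (s_gt0 : (0 < s)%N) (k_gt0 : (0 < k)%N).
Hypotheses (sn : (s %| n)%N) (ksn : (k * s <= n)%N) (SC : S \in interval_unions n s k).
Hypotheses (delta_gt0 : 0 < delta) (delta_lt1 : delta < 1) (mu_gt0 : 0 < mu) (Gamma_gt0 : 0 < Gamma).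
Hypothesis rule : search_refinement_rule s k q.

Local Notation alpha := (type1_error n delta).
Local Notation beta := (type2_error s k delta).
Local Notation lo := (lower_threshold s k delta).
Local Notation hi := (upper_threshold s k delta).
Let sigma := mu * Num.sqrt Gamma.

Let natR_ge1 (m : nat) : (0 < m)%N -> 1 <= m%:R :> R.
Proof. by move=> m0; rewrite ler1n. Qed.

Lemma type1_error_gt0 : 0 < alpha.
Proof. by rewrite divr_gt0 // mulr_gt0 // ltr0n. Qed.

Lemma type1_error_lt : alpha < 1 / 4.
Proof.
have n1 := natR_ge1 n_gt0; have d1 := delta_lt1.
by rewrite /type1_error ltr_pdivrMr ?mulr_gt0 ?ltr0n //; lra.
Qed.

Lemma type2_error_lt h : beta h < 1 / 2.
Proof.
have k1 := natR_ge1 k_gt0; have s1 := natR_ge1 s_gt0; have d1 := delta_lt1.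
by rewrite /type2_error; case: ifP => _; rewrite ltr_pdivrMr ?mulr_gt0 ?ltr0n //; nra.
Qed.

(** Comes from k s <= n. With it, ln(1 / alpha) dominates the cost of every test. *)
Lemma type1_le_type2 h : alpha <= beta h.
Proof.
have k1 := natR_ge1 k_gt0; have s1 := natR_ge1 s_gt0.
have ksnR : k%:R * s%:R <= n%:R :> R by rewrite -natrM ler_nat.
rewrite /type2_error /type1_error; case: ifP => _.
all: by rewrite ler_wpM2l ?(ltW delta_gt0) // lef_pV2 ?posrE ?mulr_gt0 ?ltr0n //; nra.
Qed.

Let a0 := type1_error_gt0.
Let a1 := type1_error_lt.
Let b1 := type2_error_lt.
Let ab := type1_le_type2.

Lemma expR_lo h : expR (lo h) = beta h / (1 - alpha).
Proof.
rewrite lnK // posrE divr_gt0 //; first exact: lt_le_trans a0 (ab h).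
by have := a1; lra.
Qed.

Lemma expR_hi h : expR (hi h) = (1 - beta h) / alpha.
Proof. by rewrite lnK // posrE divr_gt0 //; have := b1 h; lra. Qed.

Lemma lo_lt0 h : lo h < 0.
Proof.
have := a1; have := b1 h; have := ab h; have := a0 => *.
by rewrite -expR_lt1 expR_lo ltr_pdivrMr; lra.
Qed.

Lemma hi_gt0 h : 0 < hi h.
Proof.
have := a1; have := b1 h; have := ab h; have := a0 => *.
by rewrite -expR_gt1 expR_hi ltr_pdivlMr; lra.
Qed.

Lemma opp_lo_le h : - lo h <= ln (beta h)^-1 - alpha.
Proof.
have := a1; have := b1 h; have := ab h; have := a0 => A1 A2 A3 A4.
rewrite /lower_threshold -lnV ?posrE ?divr_gt0; try lra.
rewrite invf_div lnM ?posrE ?invr_gt0; try lra.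
by rewrite addrC lerD2l le_ln1Dx //; lra.
Qed.

Lemma hi_le h : hi h <= ln alpha^-1 - alpha.
Proof.
have := a1; have := b1 h; have := ab h; have := a0 => A1 A2 A3 A4.
rewrite /upper_threshold lnM ?posrE ?invr_gt0; try lra.
(* The logarithm gives the slack [beta], which is at least [alpha]. *)
by rewrite addrC lerD2l; apply: (le_trans (@le_ln1Dx _ _ _)); lra.
Qed.

(** * The procedure as a Markov chain *)

Definition noisy_step (x : state R n) (w : R) : state R n :=
  if stopped s k x.1 then x
  else update s k delta mu Gamma q x (signal mu S (q x.1) + (Num.sqrt Gamma)^-1 * w).

Lemma state_after_chain (w : nat -> R) j :
  state_after s k delta mu Gamma q S w j = chain noisy_step ([::], 0) w j.
Proof. by elim: j => //= j ->. Qed.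

(** The log-likelihood ratio of one measurement: standard deviation [sigma] and mean sigma^2 / 2
    towards the correct threshold. *)
Definition increment h (w : R) : R :=
  if q h \in S then sigma ^+ 2 / 2 + sigma * w else - (sigma ^+ 2 / 2) + sigma * w.

Lemma noisy_stepE h z w : ~~ stopped s k h ->
  noisy_step (h, z) w =
    let z' := z + increment h w in
    if hi h <= z' then (rcons h (q h, true), 0)
    else if z' <= lo h then (rcons h (q h, false), 0) else (h, z').
Proof.
move=> nh; rewrite /noisy_step (negbTE nh) /update /=.
suff -> : log_likelihood_ratio mu Gamma (signal mu S (q h) + (Num.sqrt Gamma)^-1 * w) =
  increment h w by [].
have g0 : Num.sqrt Gamma != 0 by rewrite gt_eqF // sqrtr_gt0.
have GE : Gamma = Num.sqrt Gamma ^+ 2 by rewrite sqr_sqrtr // ltW.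
rewrite log_likelihood_ratioE // /increment /signal /sigma {1}GE.
by case: ifP => _; field.
Qed.

Let measurable_increment h : measurable_fun setT (increment h).
Proof.
rewrite /increment; case: (q h \in S).
all: by apply: measurable_funD => //; exact: measurable_funM.
Qed.

Lemma measurable_noisy_step h :
  measurable_fun setT (fun p : R * R => encode (noisy_step (h, p.1) p.2)).
Proof.
have [sh|nh] := boolP (stopped s k h).
  under eq_fun do rewrite /noisy_step /= sh.
  exact: (measurable_fun_pair (measurable_cst (pickle h)) measurable_fst).
under eq_fun do rewrite noisy_stepE //.
have mz : measurable_fun setT (fun p : R * R => p.1 + increment h p.2).
  apply: measurable_funD; first exact: measurable_fst.
  exact: (measurableT_comp (measurable_increment h) measurable_snd).
under eq_fun do rewrite /= 2!(fun_if (@encode R _)).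
apply: measurable_fun_ifT => //; first exact: measurable_fun_ler.
apply: measurable_fun_ifT => //; first exact: measurable_fun_ler.
exact: (measurable_fun_pair (measurable_cst (pickle h)) mz).
Qed.

Definition testing (x : state R n) : Prop := orderly s k x.1 /\ lo x.1 < x.2 < hi x.1.

Lemma testing_init h : orderly s k h -> testing (h, 0).
Proof. by move=> oh; split => //=; rewrite lo_lt0 hi_gt0. Qed.

Lemma testing_step x w : testing x -> ~~ stopped s k x.1 -> testing (noisy_step x w).
Proof.
case: x => h z [/= oh lzu] nh; rewrite noisy_stepE //=.
case: ifPn => [_|zu]; first by apply: testing_init; exact: orderly_rcons.
case: ifPn => [_|lz]; first by apply: testing_init; exact: orderly_rcons.
by split => //=; rewrite ltNge lz ltNge zu.
Qed.

Lemma noisy_step_stopped x w : stopped s k x.1 -> noisy_step x w = x.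
Proof. by rewrite /noisy_step => ->. Qed.

(** * Expected precision *)

Section Budget.
Variable K : R.
Hypotheses (K_gt0 : 0 < K) (Ksigma : K * sigma <= alpha).
Hypothesis drift : forall y : R, 0 < y ->
  (\int[gauss]_w (let y' := y - sigma ^+ 2 / 2 + sigma * w in
                 if 0 < y' then y' + K * sigma else 0)%:E + (sigma ^+ 2 / 2)%:E
  <= (y + K * sigma)%:E)%E.

(** A measurement moves the walk by sigma^2 / 2 = mu^2 Gamma / 2 on average, so this factor converts
    distance to a threshold into precision. *)
Let A := 2 / mu ^+ 2.
(** [A] times ln(1 / alpha). Refinement queries are charged this amount whatever the truth. *)
Let hit_cost := A * ln (4 * n%:R / delta).
Let grid_cost (b : bool) := if b then hit_cost else A * ln (2 * k%:R / delta).
Local Notation qcost := (query_cost k q grid_cost hit_cost S).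
Local Notation rcost := (remaining_cost s k grid_cost hit_cost S).

Let sigma_gt0 : 0 < sigma. Proof. by rewrite mulr_gt0 // sqrtr_gt0. Qed.
Let A_gt0 : 0 < A. Proof. by rewrite divr_gt0 // exprn_gt0. Qed.
Let Ks_gt0 : 0 < K * sigma. Proof. exact: mulr_gt0. Qed.

Let hit_cost_ge0 : 0 <= hit_cost.
Proof.
rewrite mulr_ge0 ?(ltW A_gt0) // ln_ge0 // ler_pdivlMr // mul1r.
have n1 := natR_ge1 n_gt0; have d1 := delta_lt1; lra.
Qed.

Let grid_cost_ge0 b : 0 <= grid_cost b.
Proof.
rewrite /grid_cost; case: b => //.
rewrite mulr_ge0 ?(ltW A_gt0) // ln_ge0 // ler_pdivlMr // mul1r.
have k1 := natR_ge1 k_gt0; have d1 := delta_lt1; lra.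
Qed.

Definition margin (x : state R n) : R :=
  if q x.1 \in S then hi x.1 - x.2 else x.2 - lo x.1.

(** Cost left for later queries. The truncations at 0, here and in [budget], keep the potential
    nonnegative at every state, including those that no orderly run reaches. *)
Let rest h := Num.max (rcost h - qcost h) 0.

Let budget (x : state R n) : R :=
  if stopped s k x.1 then 0
  else A * Num.max (margin x + K * sigma) 0 + rest x.1.

Let rest_ge0 h : 0 <= rest h. Proof. by rewrite le_max lexx orbT. Qed.

Let budget_ge0 x : 0 <= budget x.
Proof.
rewrite /budget; case: ifP => // _.
by rewrite addr_ge0 // mulr_ge0 ?(ltW A_gt0) // le_max lexx orbT.
Qed.

Let measurable_budget h : measurable_fun setT (fun z : R => (budget (h, z))%:E).
Proof.
apply/measurable_EFinP; rewrite /budget /=; case: (stopped s k h) => //.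
apply: measurable_funD => //; apply: measurable_funM => //; apply: measurable_maxr => //.
apply: measurable_funD => //; rewrite /margin /=; case: (q h \in S); exact: measurable_funB.
Qed.

Let margin0_le h : A * (margin (h, 0) + K * sigma) <= qcost h.
Proof.
have Ka := Ksigma.
have hiE : ln alpha^-1 = ln (4 * n%:R / delta) by rewrite invf_div.
have := hi_le h; have := opp_lo_le h; rewrite hiE => Hl Hh.
have loE : ~~ (q h \in S) && search_phase k h -> ln (beta h)^-1 = ln (2 * k%:R / delta).
  by case/andP=> _ ph; rewrite /type2_error ph invf_div.
(* For zero coordinates queried in the refinement phase, which are charged [hit_cost]. *)
have lo_hit : ln (beta h)^-1 <= ln (4 * n%:R / delta).
  by rewrite -hiE ler_ln ?posrE ?invr_gt0 // ?lef_pV2 ?posrE //; exact: (lt_le_trans a0).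
rewrite /query_cost /grid_cost /hit_cost /margin /=.
have [qS|qS] := boolP (q h \in S).
  by case: ifP => _; rewrite ler_wpM2l ?(ltW A_gt0) //; lra.
case: ifP => ph; rewrite ler_wpM2l ?(ltW A_gt0) //.
  by rewrite -loE ?qS //; lra.
by lra.
Qed.

Let budget0_le h : orderly s k h -> budget (h, 0) <= rcost h.
Proof.
move=> oh; rewrite /budget /=; case: ifPn => [_|nh]; first exact: remaining_cost_ge0.
have m0 : 0 <= margin (h, 0).
  by rewrite /margin /=; case: ifP => _; rewrite ?subr0 ?sub0r ?oppr_ge0 ltW // ?hi_gt0 ?lo_lt0.
rewrite max_l; last by rewrite addr_ge0 // ltW.
have cr b := remaining_cost_rcons s_gt0 k_gt0 n_gt0 rule S grid_cost_ge0 hit_cost_ge0 b oh nh.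
have rr := remaining_cost_ge0 s k S grid_cost_ge0 hit_cost_ge0 (rcons h (q h, true)).
rewrite /rest max_l; last by rewrite subr_ge0; apply: le_trans (cr true); rewrite lerDl.
by have := margin0_le h; lra.
Qed.

Let budget_rcons h b : orderly s k h -> ~~ stopped s k h ->
  budget (rcons h (q h, b), 0) <= rest h.
Proof.
move=> oh nh; apply: le_trans (budget0_le (orderly_rcons s_gt0 k_gt0 n_gt0 rule b oh nh)) _.
rewrite /rest le_max; apply/orP; left; rewrite lerBrDl.
exact: remaining_cost_rcons.
Qed.

(** A crossing, right or wrong, leaves at most [rest h], and the first term is nonnegative; without
    a crossing y' is positive and the bound is an equality. *)
Let budget_step h z w y' : orderly s k h -> ~~ stopped s k h ->
  y' = margin (h, z + increment h w) ->
  budget (noisy_step (h, z) w) <=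
  A * (if 0 < y' then y' + K * sigma else 0) + rest h.
Proof.
move=> oh nh y'E.
have jump b : budget (rcons h (q h, b), 0) <=
    A * (if 0 < y' then y' + K * sigma else 0) + rest h.
  apply: le_trans (budget_rcons b oh nh) _; rewrite lerDr.
  by rewrite mulr_ge0 ?(ltW A_gt0) //; case: ifP => // /ltW y0; rewrite addr_ge0 // ltW.
rewrite noisy_stepE //=; case: ifPn => [_|zu]; first exact: jump.
case: ifPn => [_|lz]; first exact: jump.
rewrite /budget /= (negbTE nh); have y0 : 0 < y'.
  by rewrite y'E /margin /=; case: ifP => _; rewrite subr_gt0 ltNge.
by rewrite y0 -y'E max_l // addr_ge0 // ltW.
Qed.

Let budget_decreases x : testing x -> ~~ stopped s k x.1 ->
  (Gamma%:E + \int[gauss]_w (budget (noisy_step x w))%:E <= (budget x)%:E)%E.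
Proof.
case: x => h z [/= oh lzu] nh.
pose y := margin (h, z).
have y0 : 0 < y.
  by rewrite /y /margin /=; case/andP: lzu => lz zu; case: ifP => _; rewrite subr_gt0.
pose g (w : R) := let y' := y - sigma ^+ 2 / 2 + sigma * w in
                  if 0 < y' then y' + K * sigma else 0.
have g0 w : 0 <= g w.
  by rewrite /g /=; case: ifP => // /ltW y'0; rewrite addr_ge0 // ltW.
have mg : measurable_fun setT g.
  have ml : measurable_fun setT (fun w : R => y - sigma ^+ 2 / 2 + sigma * w).
    by apply: measurable_funD => //; exact: measurable_funM.
  apply: measurable_fun_ifT => //; first exact: measurable_fun_ltr.
  exact: measurable_funD.
(* At a non-zero coordinate the margin decreases by the increment, so the noise enters with the
   opposite sign; the Gaussian law is symmetric. *)
pose g' (w : R) := if q h \in S then g (- w) else g w.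
have g'0 w : 0 <= g' w by rewrite /g'; case: ifP.
have mg' : measurable_fun setT g'.
  rewrite /g'; case: (q h \in S) => //.
  by apply: (measurableT_comp mg) => //; exact: oppr_measurable.
have intg' : (\int[gauss]_w (g' w)%:E = \int[gauss]_w (g w)%:E)%E.
  rewrite /g'; case: (q h \in S) => //.
  rewrite (@ge0_integral_gaussN _ (fun w => (g w)%:E)) //; last exact/measurable_EFinP.
have marginE w : y - sigma ^+ 2 / 2 + sigma * (if q h \in S then - w else w) =
    margin (h, z + increment h w).
  by rewrite /y /margin /increment /=; case: (q h \in S); ring.
have stepE w : budget (noisy_step (h, z) w) <= A * g' w + rest h.
  have := budget_step oh nh (marginE w).
  by rewrite /g' /g; case: (q h \in S).
have -> : budget (h, z) = A * (y + K * sigma) + rest h.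
  by rewrite /budget /= (negbTE nh) max_l // addr_ge0 // ltW.
have mstep : measurable_fun setT (fun w : R => budget (noisy_step (h, z) w)).
  apply/measurable_EFinP.
  apply: (@measurable_fun_encoded _ _ _ _ (fun x => (budget x)%:E)) => //.
  exact: (measurableT_comp (measurable_noisy_step h) (pair1_measurable z)).
apply: (@le_trans _ _ (Gamma%:E + (\int[gauss]_w (A * g' w + rest h)%:E))%E).
  apply: leeD2l; apply: le_integral_gauss => //.
  by apply: measurable_funD => //; exact: measurable_funM.
rewrite integral_gaussD //; last 2 first.
- exact: measurable_funM.
- by move=> w; rewrite mulr_ge0 // ltW.
rewrite integral_gauss_cst integral_gaussZ ?(ltW A_gt0) // intg' EFinD addeA leeD2r //.
have GE : Gamma = A * (sigma ^+ 2 / 2).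
  by rewrite /A /sigma exprMn sqr_sqrtr ?ltW //; field; rewrite gt_eqF.
rewrite {1}GE !EFinM -muleDr // ?ge0_adde_def ?inE ?lee_fin ?divr_ge0 ?sqr_ge0 //.
by rewrite lee_wpmul2l ?lee_fin ?(ltW A_gt0) // addeC; exact: drift.
Qed.


Lemma expected_precision_le (m : R) d (T : measurableType d) (P : probability T R)
    (W : nat -> {RV P >-> R}) J :
  0 < m ->
  Num.sqrt ((2 * n%:R) / (s%:R * m) * ln ((2 * k%:R) / delta)
            + (2 * k%:R * s%:R) / m * ln ((4 * n%:R) / delta)) <= mu ->
  iid_standard_normal W ->
  (\sum_(0 <= j < J) \int[P]_omega
      (if stopped s k (chain noisy_step ([::], 0%R) (fun i => W i omega) j).1
       then 0 else Gamma%:E) <= m%:E)%E.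
Proof.
move=> m0 mu_ge W_iid.
have bE0 x : (0 <= (budget x)%:E)%E by rewrite lee_fin.
have := potential_bound measurable_noisy_step W_iid noisy_step_stopped
  (testing_init (orderly_nil n s k)) testing_step (ltW Gamma_gt0) bE0
  measurable_budget budget_decreases J.
move=> H; apply: (@le_trans _ _ (budget ([::], 0))%:E).
  by apply: le_trans H; rewrite leeDl // integral_ge0.
rewrite lee_fin; apply: le_trans (budget0_le (orderly_nil n s k)) _.
rewrite (remaining_cost_nil s_gt0 k_gt0 n_gt0) // /grid_cost /hit_cost.
set L2 := ln _; set L4 := ln _.
have mu2 : 0 < mu ^+ 2 by rewrite exprn_gt0.
have k1 := natR_ge1 k_gt0; have s1 := natR_ge1 s_gt0; have n1 := natR_ge1 n_gt0.
have d1 := delta_lt1.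
have L20 : 0 <= L2 by rewrite ln_ge0 // ler_pdivlMr // mul1r; lra.
have L40 : 0 <= L4 by rewrite ln_ge0 // ler_pdivlMr // mul1r; lra.
have nE : n%:R = (n %/ s)%:R * s%:R :> R by rewrite -natrM divnK.
have le_sub : (n %/ s - k)%:R <= (n %/ s)%:R :> R by rewrite ler_nat leq_subr.
have ksE : (k * s.-1)%:R = k%:R * s%:R - k%:R :> R.
  by rewrite -subn1 mulnBr muln1 natrB ?leq_pmulr // natrM.
move: mu_ge; rewrite -/L2 -/L4 nE ksE.
set X := (X in Num.sqrt X) => mu_ge.
have XE : m * X = 2 * ((n %/ s)%:R * L2 + k%:R * s%:R * L4).
  by rewrite /X; field; rewrite !gt_eqF //; lra.
(* [Num.sqrt] vanishes on negative arguments, hence the case distinction. *)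
have Xmu : X <= mu ^+ 2.
  have [X0|X0] := leP 0 X; last by rewrite ltW // (lt_trans X0).
  by rewrite -(sqr_sqrtr X0) ler_sqr ?nnegrE ?sqrtr_ge0 // ltW.
(* The [k] hits and the k (s - 1) reserved refinement queries together give k s terms [L4]. *)
rewrite (_ : _ + _ = A * ((n %/ s - k)%:R * L2 + k%:R * s%:R * L4)); last by ring.
rewrite /A mulrAC ler_pdivrMr //; apply: (@le_trans _ _ (m * X)); last by rewrite ler_wpM2l // ltW.
by rewrite XE ler_wpM2l // lerD2r ler_wpM2r.
Qed.

End Budget.



(** * Error probability *)

Section ErrorProbability.

(** The bound beta / (1 - alpha) for a test at a non-zero coordinate; it also covers alpha / (1 -
    beta), since alpha <= beta < 1/2. *)
Let refinement_error := delta / (4 * k%:R * s%:R) / (1 - alpha).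
(** At a zero coordinate the value is 2 alpha, which bounds alpha / (1 - beta) because beta <
    1/2. *)
Let grid_error (b : bool) :=
  if b then delta / (2 * k%:R) / (1 - alpha) else delta / (2 * n%:R).
Local Notation qcost := (query_cost k q grid_error refinement_error S).
Local Notation rcost := (remaining_cost s k grid_error refinement_error S).

Let refinement_error_ge0 : 0 <= refinement_error.
Proof.
have A1 := a1; rewrite divr_ge0 ?divr_ge0 ?mulr_ge0 ?(ltW delta_gt0) //.
by rewrite subr_ge0; lra.
Qed.

Let grid_error_ge0 b : 0 <= grid_error b.
Proof.
have A1 := a1; rewrite /grid_error; case: b; rewrite !divr_ge0 ?mulr_ge0 ?(ltW delta_gt0) //.
by rewrite subr_ge0; lra.
Qed.

Let rest h := Num.max (rcost h - qcost h) 0.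
Let rest_ge0 h : 0 <= rest h. Proof. by rewrite le_max lexx orbT. Qed.

(** The likelihood ratio against the truth, scaled by the wrong threshold: a martingale that is at
    least 1 where the test errs. *)
Let test_error h (z : R) : R :=
  if q h \in S then expR (lo h - z) else expR (z - hi h).

Let test_error_ge0 h z : 0 <= test_error h z.
Proof. by rewrite /test_error; case: ifP => _; exact: expR_ge0. Qed.

(** Frozen at 1 by the first wrong answer, so that its mean bounds the probability of one. *)
Let risk (x : state R n) : R :=
  if ~~ consistent x.1 S then 1
  else if stopped s k x.1 then 0 else test_error x.1 x.2 + rest x.1.

Let risk_ge0 x : 0 <= risk x.
Proof. by rewrite /risk; case: ifP => // _; case: ifP => // _; exact: addr_ge0. Qed.

Let measurable_test_error h : measurable_fun setT (test_error h).
Proof.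
rewrite /test_error; case: (q h \in S).
all: by apply: measurableT_comp => //; exact: measurable_funB.
Qed.

Let measurable_risk h : measurable_fun setT (fun z : R => (risk (h, z))%:E).
Proof.
apply/measurable_EFinP; rewrite /risk /=; case: (~~ consistent h S) => //.
by case: (stopped s k h) => //; exact: measurable_funD.
Qed.

Let test_error0_le h : test_error h 0 <= qcost h.
Proof.
have A0 := a0; have A1 := a1; have B1 := b1 h; have AB := ab h.
have loE : expR (lo h - 0) = beta h / (1 - alpha) by rewrite subr0 expR_lo.
have hiE : expR (0 - hi h) = alpha / (1 - beta h) by rewrite sub0r expRN expR_hi invf_div.
have n0 : 0 < n%:R :> R by rewrite ltr0n.
rewrite /test_error /query_cost /grid_error /refinement_error loE hiE.
have [ph|ph] := boolP (search_phase k h); last first.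
  have -> : delta / (4 * k%:R * s%:R) = beta h by rewrite /type2_error (negbTE ph).
  case: ifP => // _; rewrite ler_pdivrMr; last by lra.
  by rewrite mulrAC ler_pdivlMr; [nra|lra].
have -> : delta / (2 * k%:R) = beta h by rewrite /type2_error ph.
case: ifP => // _; rewrite ler_pdivrMr; last by lra.
have -> : delta / (2 * n%:R) = 2 * alpha by rewrite /type1_error; field; rewrite gt_eqF.
by nra.
Qed.

Let risk0_le h : orderly s k h -> consistent h S -> risk (h, 0) <= rcost h.
Proof.
move=> oh ch; rewrite /risk /= ch /=; case: ifPn => [_|nh]; first exact: remaining_cost_ge0.
have cr := remaining_cost_rcons s_gt0 k_gt0 n_gt0 rule S grid_error_ge0 refinement_error_ge0 true oh nh.
have rr := remaining_cost_ge0 s k S grid_error_ge0 refinement_error_ge0 (rcons h (q h, true)).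
rewrite /rest max_l; last by rewrite subr_ge0; apply: le_trans cr; rewrite lerDl.
by have := test_error0_le h; lra.
Qed.

(** A right answer leaves at most [rest h]; at a wrong one [test_error] has reached 1, with or
    without overshoot, and pays for the risk 1. *)
Let risk_step h z w : orderly s k h -> ~~ stopped s k h -> consistent h S ->
  risk (noisy_step (h, z) w) <= test_error h (z + increment h w) + rest h.
Proof.
move=> oh nh ch.
have right_answer : risk (rcons h (q h, q h \in S), 0) <= test_error h (z + increment h w) + rest h.
  have ch' : consistent (rcons h (q h, q h \in S)) S.
    by rewrite /consistent all_rcons /= eqxx.
  apply: le_trans (risk0_le (orderly_rcons s_gt0 k_gt0 n_gt0 rule _ oh nh) ch') _.
  rewrite ler_wpDl // /rest le_max; apply/orP; left; rewrite lerBrDl.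
  exact: remaining_cost_rcons.
have wrong_answer : 1 <= test_error h (z + increment h w) ->
    risk (rcons h (q h, q h \notin S), 0) <= test_error h (z + increment h w) + rest h.
  move=> t1; rewrite /risk /= /consistent all_rcons /=.
  by case: (q h \in S) => /=; rewrite -[leLHS]addr0 lerD.
rewrite noisy_stepE //=; move: right_answer wrong_answer; rewrite /test_error.
set z' := z + _; case qS: (q h \in S) => /= right_answer wrong_answer.
  case: ifPn => [//|zu]; case: ifPn => [z'l|lz].
    by apply: wrong_answer; rewrite -[leLHS]expR0 ler_expR subr_ge0.
  by rewrite /risk /= ch (negbTE nh) /test_error qS.
case: ifPn => [z'u|zu].
  by apply: wrong_answer; rewrite -[leLHS]expR0 ler_expR subr_ge0.
case: ifPn => [//|lz].
by rewrite /risk /= ch (negbTE nh) /test_error qS.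
Qed.

(** One step multiplies [test_error] by an exponential of mean 1. *)
Let integral_test_error h z :
  (\int[gauss]_w (test_error h (z + increment h w))%:E = (test_error h z)%:E)%E.
Proof.
pose c := if q h \in S then - sigma else sigma.
have E w : test_error h (z + increment h w) =
    test_error h z * expR (c * w - c ^+ 2 / 2).
  rewrite /test_error /increment /c; case: (q h \in S); rewrite -expRD; congr expR.
    by field.
  by field.
under eq_integral do rewrite E.
rewrite integral_gaussZ // ?integral_gauss_expR ?mule1 //.
by apply: measurableT_comp => //; apply: measurable_funB => //; exact: measurable_funM.
Qed.

Let risk_decreases x : testing x -> ~~ stopped s k x.1 ->
  (0%:E + \int[gauss]_w (risk (noisy_step x w))%:E <= (risk x)%:E)%E.
Proof.
case: x => h z [/= oh lzu] nh; rewrite add0e.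
have mstep : measurable_fun setT (fun w : R => risk (noisy_step (h, z) w)).
  apply/measurable_EFinP.
  apply: (@measurable_fun_encoded _ _ _ _ (fun x => (risk x)%:E)) => //.
  exact: (measurableT_comp (measurable_noisy_step h) (pair1_measurable z)).
rewrite {2}/risk /= (negbTE nh); case: ifPn => [ch|].
  rewrite -[leRHS]integral_gauss_cst; apply: le_integral_gauss => // w.
  (* Later answers do not repair a wrong one. *)
  suff bad b : ~~ consistent (rcons h (q h, b)) S.
    rewrite noisy_stepE //=; case: ifP => _; first by rewrite /risk bad.
    by case: ifP => _; rewrite /risk ?bad ?ch.
  by rewrite /consistent all_rcons /= negb_and -/(consistent h S) ch orbT.
rewrite negbK => ch.
have mte : measurable_fun setT (fun w : R => test_error h (z + increment h w)).
  apply: (measurableT_comp (measurable_test_error h)).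
  exact: measurable_funD.
apply: (@le_trans _ _ (\int[gauss]_w (test_error h (z + increment h w) + rest h)%:E)%E).
  apply: le_integral_gauss => //; first exact: measurable_funD.
  by move=> w; exact: risk_step.
by rewrite integral_gaussD // integral_gauss_cst integral_test_error EFinD.
Qed.

Lemma error_budget : rcost [::] <= delta.
Proof.
rewrite (remaining_cost_nil s_gt0 k_gt0 n_gt0) // /grid_error /refinement_error.
have k1 := natR_ge1 k_gt0; have s1 := natR_ge1 s_gt0; have n1 := natR_ge1 n_gt0.
have d1 := delta_lt1; have d0 := delta_gt0.
have nE : n%:R = (n %/ s)%:R * s%:R :> R by rewrite -natrM divnK.
have ksnR : k%:R * s%:R <= n%:R :> R by rewrite -natrM ler_nat.
have kns : (k <= n %/ s)%N by rewrite leq_divRL.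
have subE : (n %/ s - k)%:R = (n %/ s)%:R - k%:R :> R by rewrite natrB.
have ksE : (k * s.-1)%:R = k%:R * s%:R - k%:R :> R.
  by rewrite -subn1 mulnBr muln1 natrB ?leq_pmulr // natrM.
have a_gt0 : 0 < (n %/ s)%:R :> R by rewrite ltr0n divn_gt0 // dvdn_leq.
rewrite subE ksE.
(* Divided by [delta], the total is t/2 - k v/2 + c/2 + c (1 - t)/4. The term k v/2, saved on the
   [k] grid coordinates in [S], pays for the excess of [c] over 1. *)
pose t : R := s%:R^-1; pose v : R := n%:R^-1; pose c := (1 - alpha)^-1.
have A0 := a0; have A1 := a1.
have t1 : t <= 1 by rewrite invf_le1 //; lra.
have v0 : 0 < v by rewrite invr_gt0; lra.
have v1 : v <= 1 by rewrite invf_le1 //; lra.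
have av : alpha = delta * v / 4 by rewrite /type1_error /v; field; rewrite gt_eqF //; lra.
(* Because alpha < v / 4 and v <= 1. *)
have c_le : c <= 1 + v / 3.
  by rewrite /c -[leLHS]mul1r ler_pdivrMr; [rewrite av; nra|lra].
have -> : ((n %/ s)%:R - k%:R) * (delta / (2 * n%:R)) = delta * (t / 2 - k%:R * v / 2).
  by rewrite /t /v nE; field; rewrite !gt_eqF //; lra.
have -> : k%:R * (delta / (2 * k%:R) / (1 - alpha)) = delta * (c / 2).
  by rewrite /c; field; rewrite !gt_eqF //; lra.
have -> : (k%:R * s%:R - k%:R) * (delta / (4 * k%:R * s%:R) / (1 - alpha)) =
    delta * (c * (1 - t) / 4).
  by rewrite /c /t; field; rewrite !gt_eqF //; lra.
rewrite -!mulrDr -[leRHS]mulr1 ler_wpM2l //; first exact: ltW.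
have : k%:R * v >= v by rewrite ler_peMl // ltW.
by nra.
Qed.

(** [risk] is at least the indicator of this event, and its mean never exceeds its initial value. *)
Lemma inconsistent_probability_le d (T : measurableType d) (P : probability T R)
    (W : nat -> {RV P >-> R}) J :
  iid_standard_normal W ->
  (P [set omega | ~~ consistent (chain noisy_step ([::], 0%R) (fun i => W i omega) J).1 S]%classic
   <= delta%:E)%E.
Proof.
move=> W_iid; have rE0 x : (0 <= (risk x)%:E)%E by rewrite lee_fin.
have H := potential_bound measurable_noisy_step W_iid noisy_step_stopped
  (testing_init (orderly_nil n s k)) testing_step (lexx 0) rE0
  measurable_risk risk_decreases J.
have {}H : (\int[P]_omega (risk (chain noisy_step ([::], 0%R) (fun i => W i omega) J))%:E
    <= (risk ([::], 0%R))%:E)%E.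
  apply: le_trans H; rewrite leeDr //; apply: sume_ge0 => j _.
  by apply: integral_ge0 => omega _; case: ifP.
apply: (@le_trans _ _ (risk ([::], 0%R))%:E); last first.
  by rewrite lee_fin; apply: le_trans error_budget; exact: risk0_le (orderly_nil n s k) _.
apply: le_trans H.
have mbad := measurable_chain_pred ([::], 0%R) measurable_noisy_step W
  (fun h => ~~ consistent h S) J.
rewrite -[X in (P X <= _)%E]setIT -integral_indic //.
apply: ge0_le_integral => //.
- by apply/measurable_EFinP; exact: measurable_indic.
- apply: (@measurable_fun_encoded _ _ _ _ (fun x => (risk x)%:E)) => //.
  apply: (@measurable_chain _ _ _ _ measurable_noisy_step _ _ (fun i => W i : T -> R)) => i _.
  exact: measurable_funPT.
- move=> omega _; rewrite lee_fin indicE; case: (boolP (_ \in _)) => [|_]; last exact: risk_ge0.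
  by rewrite inE /risk /= => ->.
Qed.

End ErrorProbability.

Lemma estimate_consistent h : stopped s k h -> consistent h S -> estimate s k h = S.
Proof.
move=> /andP[_ c1] ch; have Sc : S \in candidates s k h by rewrite inE SC ch.
rewrite /estimate; case: pickP => [A Ac|/(_ S)]; last by rewrite Sc.
exact: (card_le1_eqP c1).
Qed.

Local Notation run := (state_after s k delta mu Gamma q S).
Local Notation halts := (halted s k delta mu Gamma q S).

Lemma state_after_halted (w : nat -> R) j i : halts w j -> run w (j + i) = run w j.
Proof.
move=> hj; elim: i => [|i IH]; first by rewrite addn0.
by rewrite addnS /= IH; move: hj; rewrite /halted => ->.
Qed.

Lemma estimator_halted (w : nat -> R) j : halts w j ->
  estimator s k delta mu Gamma q S w = estimate s k (run w j).1.
Proof.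
move=> hj; rewrite /estimator; case: pselect => [ex|[]]; last by exists j.
case: ex_minnP => i hi /(_ j hj) ij.
by rewrite -(subnKC ij) state_after_halted.
Qed.

Lemma estimator_never_halted (w : nat -> R) : (forall j, ~~ halts w j) ->
  estimator s k delta mu Gamma q S w = finset.set0.
Proof.
move=> nh; rewrite /estimator; case: pselect => // -[j hj].
by have := nh j; rewrite hj.
Qed.

(** * From finite horizons to the whole run *)

Section RandomNoise.
Local Open Scope classical_set_scope.
Local Open Scope ereal_scope.
Context d (T : measurableType d) (P : probability T R) (W : nat -> {RV P >-> R}).
Hypothesis W_iid : iid_standard_normal W.
Variable m : R.
Hypothesis m_gt0 : (0 < m)%R.
Hypothesis precision_le : forall J,
  \sum_(0 <= j < J) \int[P]_omega
      (if stopped s k (chain noisy_step ([::], 0%R) (fun i => W i omega) j).1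
       then 0 else Gamma%:E) <= m%:E.

Let noise omega i := W i omega.

Let measurable_run (Q : pred (history n)) j : measurable [set omega | Q (run (noise omega) j).1].
Proof.
have := measurable_chain_pred ([::], 0%R) measurable_noisy_step W Q j.
by congr measurable; apply/seteqP; split => omega /=; rewrite state_after_chain.
Qed.

Let measurable_halts j : measurable [set omega | ~~ halts (noise omega) j].
Proof. exact: (measurable_run (fun h => ~~ stopped s k h) j). Qed.

Let measurable_cost j :
  measurable_fun setT (fun omega => if halts (noise omega) j then 0 else Gamma%:E).
Proof.
apply: measurable_fun_ifT => //; apply: (measurable_fun_bool true); rewrite setTI.
exact: (measurable_run (stopped s k) j).
Qed.

Let cost_ge0 j omega : 0 <= (if halts (noise omega) j then 0 else Gamma%:E).
Proof. by case: ifP => // _; rewrite lee_fin ltW. Qed.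

Let partial_precision_le J :
  \sum_(0 <= j < J) \int[P]_omega (if halts (noise omega) j then 0 else Gamma%:E) <= m%:E.
Proof.
apply: le_trans (precision_le J); rewrite le_eqVlt; apply/orP; left; apply/eqP.
by apply: eq_bigr => j _; apply: eq_integral => omega _; rewrite /halted state_after_chain.
Qed.

Lemma expected_total_precision_le :
  \int[P]_omega total_precision s k delta mu Gamma q S (fun j => W j omega) <= m%:E.
Proof.
rewrite /total_precision.
under eq_integral => omega _ do rewrite eseries_mkcond.
under eq_integral => omega _.
  rewrite (eq_eseriesr (g := fun j => if halts (noise omega) j then 0 else Gamma%:E)).
    over.
  by move=> j _; case: (halted _ _ _ _ _ _ _ _ _).
rewrite integral_nneseries //; apply: lime_le.
  by apply: is_cvg_nneseries => j _ _; exact: integral_ge0.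
by near=> J; exact: partial_precision_le.
Unshelve. all: end_near. Qed.

Let never := \bigcap_j [set omega | ~~ halts (noise omega) j].

Let measurable_never : measurable never.
Proof. exact: bigcapT_measurable. Qed.

(** On [never] each of the first J measurements costs [Gamma], so J Gamma P(never) <= m for every
    J. *)
Lemma never_halts_negligible : P never = 0.
Proof.
have PE : P never = (fine (P never))%:E by rewrite fineK // fin_num_measure.
have p0 : (0 <= fine (P never))%R by exact: fine_ge0.
have bound J : (J%:R * (Gamma * fine (P never)) <= m)%R.
  rewrite -lee_fin; apply: le_trans (partial_precision_le J).
  rewrite mulr_natl -[in leLHS](subn0 J) -sumr_const_nat -sumEFin.
  apply: lee_sum => j _; rewrite EFinM -PE -[X in P X]setIT -integral_indic //.
  rewrite -ge0_integralZl_EFin //; last 2 first.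
  - by apply/measurable_EFinP; exact: measurable_indic.
  - exact: ltW.
  apply: ge0_le_integral => //.
  - by move=> omega _; rewrite mule_ge0 // lee_fin ltW.
  - apply: emeasurable_funM => //; apply/measurable_EFinP; exact: measurable_indic.
  - move=> omega _; rewrite indicE; case: (boolP (_ \in _)) => [|_]; last by rewrite mule0.
    by rewrite inE => /(_ j I) /negbTE ->; rewrite mule1.
rewrite PE; congr (_%:E); apply/eqP; rewrite eq_le p0 andbT leNgt; apply/negP => pgt0.
have g0 : (0 < Gamma * fine (P never))%R by exact: mulr_gt0.
have := bound (Num.bound (m / (Gamma * fine (P never)))).
apply/negP; rewrite -ltNge -ltr_pdivrMr //.
by apply: archi_boundP; rewrite divr_ge0 // ltW.
Qed.

Let wrong j := [set omega | ~~ consistent (run (noise omega) j).1 S].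

Let wrong_nondecreasing : nondecreasing_seq wrong.
Proof.
apply/nondecreasing_seqP => j; apply/subsetPset => omega; rewrite /wrong /=.
case: ifP => // _; rewrite /update; case: ifP => _; last case: ifP => _ //.
all: by rewrite /= /consistent all_rcons negb_and => ->; rewrite orbT.
Qed.

(** An error requires never halting or a wrong answer. The events [wrong j] increase with time, so
    their common bound passes to the union. *)
Lemma estimator_error_le :
  P [set omega | estimator s k delta mu Gamma q S (fun j => W j omega) <> S] <= delta%:E.
Proof.
set E := [set omega | _].
(* The estimator is defined by a classical case distinction on the whole path; this countable
   description makes the error event measurable. *)
have EE : E = (never `&` [set _ | finset.set0 <> S]) `|`
    \bigcup_j [set omega | stopped s k (run (noise omega) j).1 &&
                          (estimate s k (run (noise omega) j).1 != S)].
  apply/seteqP; split => omega; rewrite /E /=.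
    have [[j hj]|nh] := pselect (exists j, halts (noise omega) j).
      rewrite (estimator_halted hj) => /eqP neS; right; exists j => //=.
      by rewrite neS andbT.
    have nh' j : ~~ halts (noise omega) j by apply/negP => hj; apply: nh; exists j.
    by rewrite (estimator_never_halted nh') => neS; left; split => // j _; exact: nh'.
  case=> [[nh neS]|[j _ /= /andP[hj /eqP neS]]].
    by rewrite (estimator_never_halted (fun j => nh j I)).
  by rewrite (estimator_halted (j := j)).
have wrongE j : wrong j =
    [set omega | ~~ consistent (chain noisy_step ([::], 0%R) (fun i => W i omega) j).1 S].
  by apply/seteqP; split => omega; rewrite /wrong /= state_after_chain.
have mwrong j : measurable (wrong j).
  exact: (measurable_run (fun h => ~~ consistent h S) j).
have mE : measurable E.
  rewrite EE; apply: measurableU; last first.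
    apply: bigcupT_measurable => j.
    exact: (measurable_run (fun h => stopped s k h && (estimate s k h != S)) j).
  apply: measurableI => //; have [neS|eS] := pselect (finset.set0 <> S).
    by rewrite (_ : [set _ | _] = setT) //; apply/seteqP; split.
  by rewrite (_ : [set _ | _] = set0) //; apply/seteqP; split.
have mU : measurable (\bigcup_j wrong j) by exact: bigcupT_measurable.
have sub : E `<=` never `|` \bigcup_j wrong j.
  rewrite EE => omega [[nh _]|[j _ /= /andP[hj neS]]]; first by left.
  right; exists j => //=; apply: contra neS => ch; apply/eqP; exact: estimate_consistent.
apply: le_trans (le_measure _ _ _ sub) _; rewrite ?inE //; first exact: measurableU.
apply: (@le_trans _ _ (P never + P (\bigcup_j wrong j))); first exact: measureU2.
rewrite never_halts_negligible add0e.
have cvg := @nondecreasing_cvg_mu _ _ _ P _ mwrong mU wrong_nondecreasing.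
rewrite -(cvg_lim _ cvg) //; apply: lime_le; first by apply/cvg_ex; exists (P (\bigcup_j wrong j)).
near=> J; rewrite /= wrongE; exact: inconsistent_probability_le.
Unshelve. all: end_near. Qed.

End RandomNoise.

End SPRT.

Theorem proposition5 (R : realType) (n s k : nat) (m delta mu : R)
    (q : history n -> 'I_n) :
  (0 < n)%N -> (0 < s)%N -> (0 < k)%N -> (s %| n)%N -> (k * s <= n)%N ->
  0 < m -> 0 < delta < 1 -> 0 < mu ->
  Num.sqrt ((2 * n%:R) / (s%:R * m) * ln ((2 * k%:R) / delta)
            + (2 * k%:R * s%:R) / m * ln ((4 * n%:R) / delta)) <= mu ->
  search_refinement_rule s k q ->
  exists2 Gamma0 : R, 0 < Gamma0 &
    forall Gamma : R, 0 < Gamma <= Gamma0 ->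
    forall (d : measure_display) (T : measurableType d) (P : probability T R)
           (W : nat -> {RV P >-> R}),
      iid_standard_normal W ->
      (\big[maxe/-oo]_(S in interval_unions n s k)
         P [set omega | estimator s k delta mu Gamma q S (fun j => W j omega) <> S]%classic
       <= delta%:E)%E
      /\
      (forall S : {set 'I_n}, S \in interval_unions n s k ->
         (\int[P]_omega
            total_precision s k delta mu Gamma q S (fun j => W j omega)
          <= m%:E)%E).
Proof.
move=> n_gt0 s_gt0 k_gt0 sn ksn m_gt0 /andP[delta_gt0 delta_lt1] mu_gt0 mu_ge rule.
have [K K_gt0 drift] := @gauss_drift R.
have a_gt0 : 0 < type1_error n delta by exact: type1_error_gt0.
(* The drift estimate needs sigma <= 1 and the overshoot term needs K sigma <= alpha; as sigma = mu
   sqrt(Gamma), both hold once Gamma <= (r / mu)^2. *)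
pose r := Num.min 1 (type1_error n delta / K).
have r_gt0 : 0 < r by rewrite lt_min ltr01 divr_gt0.
exists ((r / mu) ^+ 2); first by rewrite exprn_gt0 // divr_gt0.
move=> Gamma /andP[Gamma_gt0 Gamma_le] d T P W W_iid.
pose sigma := mu * Num.sqrt Gamma.
have sigma_gt0 : 0 < sigma by rewrite mulr_gt0 // sqrtr_gt0.
have sigma_le : sigma <= r.
  rewrite /sigma mulrC -ler_pdivlMr //.
  have rmu_ge0 : 0 <= r / mu by rewrite divr_ge0 // ltW.
  by rewrite -[leRHS](ger0_norm rmu_ge0) -sqrtr_sqr ler_wsqrtr.
have sigma_le1 : sigma <= 1 by apply: le_trans sigma_le _; rewrite ge_min lexx.
have Ksigma : K * sigma <= type1_error n delta.
  rewrite mulrC -ler_pdivlMr //; apply: le_trans sigma_le _.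
  by rewrite ge_min lexx orbT.
have drift_sigma y := drift sigma y (introT andP (conj sigma_gt0 sigma_le1)).
have precision S (SC : S \in interval_unions n s k) J :=
  expected_precision_le n_gt0 s_gt0 k_gt0 sn ksn SC delta_gt0 delta_lt1 mu_gt0 Gamma_gt0
    rule K_gt0 Ksigma drift_sigma J m_gt0 mu_ge W_iid.
split.
  apply: bigmax_le => [|S SC]; first exact: leNye.
  exact: (estimator_error_le n_gt0 s_gt0 k_gt0 sn ksn SC delta_gt0 delta_lt1
    Gamma_gt0 rule W_iid m_gt0 (precision S SC)).
move=> S SC.
exact: (expected_total_precision_le Gamma_gt0 (precision S SC)).
Qed.
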